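(* Let $X_h:\mathbb{S}^1\times[0,T]\to\mathbb{R}^2$, $X_h(\xi,t)=\sum_{j=1}^N X_j(t)\varphi_j(\xi)$, be a semidiscrete solution (as defined in the context) with initial condition $X_h(\cdot,0)=I_hX^0$. Suppose that the initial curve $X_h(\cdot,0)=I_hX^0$ is a convex $N$-polygon, and that $q_j(t)=|X_j(t)-X_{j-1}(t)|>0$ for all $1\le j\le N$ (throughout the evolution, $t\in[0,T]$). Then the evolved polygon $(X_1(t),\ldots,X_N(t))$ is a convex $N$-polygon for all $t\in[0,T]$.
   Context: Let $\mathbb{S}^1=[0,2\pi]$ with endpoints identified, and let $0=\xi_0<\xi_1<\dots<\xi_N=2\pi$ be a partition, $N\ge 3$, $I_j=[\xi_{j-1},\xi_j]$, $h_j=\xi_j-\xi_{j-1}$, $h=\max_j h_j$. All indices are periodic modulo $N$. Let $V_h$ be the space of continuous periodic functions $v:\mathbb{S}^1\to\mathbb{R}^2$ that are affine on each $I_j$, let $\varphi_j$ be the scalar continuous periodic piecewise affine nodal basis function with $\varphi_j(\xi_i)=\delta_{ij}$, and for continuous $v:\mathbb{S}^1\to\mathbb{R}^2$ let $I_hv=\sum_{j=1}^N v(\xi_j)\varphi_j$. For $(a,b)\in\mathbb{R}^2$ put $(a,b)^\perp=(-b,a)$. $X^0:\mathbb{S}^1\to\mathbb{R}^2$ is a given initial curve. Semidiscrete solution: a function $X_h(\xi,t)=\sum_{j=1}^NX_j(t)\varphi_j(\xi)$ on $\mathbb{S}^1\times[0,T]$ with $X_h(\cdot,0)=I_hX^0$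 satisfying, for all $v_h\in V_h$ and all $t$, $$\int_{\mathbb{S}^1}|\partial_\xi X_h|\,\partial_tX_h\cdot v_h\,d\xi+\int_{\mathbb{S}^1}\frac{\partial_\xi X_h}{|\partial_\xi X_h|}\cdot\partial_\xi v_h\,d\xi+\int_{\mathbb{S}^1}\frac{\mathbf{h}^2|\partial_\xi X_h|}{6}\,\partial_\xi\partial_tX_h\cdot\partial_\xi v_h\,d\xi+\int_{\mathbb{S}^1}\frac{2\pi}{L_h}(\partial_\xi X_h)^\perp\cdot v_h\,d\xi=0,$$ where $\mathbf{h}=h_j$ on $I_j$, $q_j=|X_j-X_{j-1}|$ and $L_h=\sum_{j=1}^Nq_j$ is the perimeter. Equivalently, the vertices satisfy the ODE system $$\frac{q_j+q_{j+1}}{2}\dot X_j=\frac{X_{j+1}-X_j}{q_{j+1}}-\frac{X_j-X_{j-1}}{q_j}-\frac{\pi}{L_h}(X_{j+1}-X_{j-1})^\perp,\qquad 1\le j\le N.$$ The image of $X_h(\cdot,t)$ is the closed polygonal curve with successive vertices $X_1(t),\dots,X_N(t)$. An $N$-polygon $(Y_1,\dots,Y_N)$ is a closed polygon with vertices $Y_j$ and edges $\overline{Y_{j-1}Y_j}$ having exactly $N$ sides, i.e. no three adjacent vertices are collinear. It is called convex if it is the boundary of a convex set. The vertices are listed in anticlockwise order along the polygon. *)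

(* Defs.v *)
From HB Require Import structures.
From mathcomp Require Import all_boot all_order all_algebra.
From mathcomp Require Import all_classical all_reals all_analysis.

Set Implicit Arguments.
Unset Strict Implicit.
Unset Printing Implicit Defensive.

Import Order.TTheory GRing.Theory Num.Theory.
Import numFieldNormedType.Exports.

Local Open Scope classical_set_scope.
Local Open Scope ring_scope.

(* The library norm on a product is the sup norm, hence the separate
   Euclidean norm [enorm]; the topology is the same. *)
Notation plane R := (R^o * R^o)%type.

Section Plane.
Context {R : realType}.
Implicit Types p q : plane R.

Definition perp p : plane R := (- p.2, p.1).
Definition dot p q : R := p.1 * q.1 + p.2 * q.2.
Definition enorm p : R := Num.sqrt (dot p p).

Definition segment p q : set (plane R) :=
  [set (1 - s) *: p + s *: q | s in `[0, 1]].

Definition collinear p q r : Prop :=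
  exists (a d : plane R), d != 0 /\
    forall x, x \in [:: p; q; r] -> exists s : R, x = a + s *: d.

Definition boundary (A : set (plane R)) : set (plane R) :=
  closure A `\` interior A.

End Plane.

(* Polygons with vertices indexed by the integers modulo N, represented by
   'I_N with its cyclic successor [ordS] and predecessor [ord_pred]. *)
Section Polygon.
Context {R : realType} (N : nat).
Implicit Types Y : 'I_N -> plane R.

Definition edge_length Y (j : 'I_N) : R := enorm (Y j - Y (ord_pred j)).

Definition perimeter Y : R := \sum_(j < N) edge_length Y j.

Definition polygon_trace Y : set (plane R) :=
  \bigcup_(j in [set: 'I_N]) segment (Y (ord_pred j)) (Y j).

(* shoelace formula; dot (perp p) q is the determinant of (p, q) *)
Definition signed_area Y : R :=
  2^-1 * \sum_(j < N) dot (perp (Y (ord_pred j))) (Y j).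

(* Distinctness of the vertices rules out lists that go several times
   around the same closed curve, which [polygon_trace] does not see. *)
Definition anticlockwise Y : Prop := injective Y /\ 0 < signed_area Y.

Definition Npolygon Y : Prop :=
  anticlockwise Y /\
  forall j : 'I_N, ~ collinear (Y (ord_pred j)) (Y j) (Y (ordS j)).

Definition convex_Npolygon Y : Prop :=
  Npolygon Y /\
  exists C : set (plane R),
    convex_set (C : set (convex_lmodType (plane R))) /\
    polygon_trace Y = boundary C.

End Polygon.

(* Functions on the circle are functions on [0, 2 pi] with equal values at
   the two endpoints; their values elsewhere are irrelevant.  Only the nodes
   xi 0, ..., xi N are used, and the index 0 : 'I_N stands for the class of
   both 0 and N. *)
Section FiniteElements.
Context {R : realType} (N : nat) (xi : nat -> R).

Definition partition_of_circle : Prop :=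
  [/\ xi 0%N = 0, xi N = 2 * pi & forall j, (j < N)%N -> xi j < xi j.+1].

Definition continuous_on_circle (V : normedModType R) (v : R -> V) : Prop :=
  {within `[0, 2 * pi]%classic, continuous v} /\ v 0 = v (2 * pi).

Definition piecewise_affine (V : normedModType R) (v : R -> V) : Prop :=
  continuous_on_circle v /\
  forall j, (j < N)%N -> exists a b : V,
    forall x, x \in `[xi j, xi j.+1] -> v x = a + x *: b.

Definition nodal_basis (phi : 'I_N -> R -> R) : Prop :=
  forall j : 'I_N, piecewise_affine (phi j : R -> R^o) /\
    forall i : 'I_N, phi j (xi i) = (i == j)%:R.

Definition Vh (v : R -> plane R) : Prop := piecewise_affine v.

(* The mesh function bold h; its values at the nodes do not matter since it
   only occurs under an integral. *)
Definition meshsize (x : R) : R :=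
  \sum_(j < N | xi j <= x < xi j.+1) (xi j.+1 - xi j).

Definition interpolant (phi : 'I_N -> R -> R) (v : R -> plane R) (x : R) :
    plane R :=
  \sum_(j < N) phi j x *: v (xi j).

End FiniteElements.

(* Derivatives at t of a function on [0, T], one-sided at t = 0 and t = T. *)
Section TimeDerivative.
Context {R : realType} {V : normedModType R} (T : R).

Definition time_quotient (f : R -> V) (t s : R) : V :=
  (s - t)^-1 *: (f s - f t).

Definition time_filter (t : R) : set_system R := within `[0, T] t^'.

Definition time_derivable (f : R -> V) (t : R) : Prop :=
  cvg (time_quotient f t @ time_filter t).

Definition time_derive (f : R -> V) (t : R) : V :=
  lim (time_quotient f t @ time_filter t).

End TimeDerivative.

Section Semidiscrete.
Context {R : realType} (N : nat) (xi : nat -> R) (T : R).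
Implicit Types (phi : 'I_N -> R -> R) (X : 'I_N -> R -> plane R).

Definition Xh phi X (x t : R) : plane R := \sum_(j < N) phi j x *: X j t.

Definition integral_circle (f : R -> R) : R :=
  \int[lebesgue_measure]_(x in `[0, 2 * pi]) f x.

(* The spatial derivatives below exist except at the nodes, a null set. *)
Definition weak_formulation phi X (v : R -> plane R) (t : R) : Prop :=
  let dx_X x := derive1 (fun y => Xh phi X y t) x in
  let dt_X x := time_derive T (Xh phi X x) t in
  let dx_dt_X x := derive1 dt_X x in
  let dx_v x := derive1 v x in
  let Lh := perimeter (fun j => X j t) in
    integral_circle (fun x => enorm (dx_X x) * dot (dt_X x) (v x))
  + integral_circle (fun x => dot ((enorm (dx_X x))^-1 *: dx_X x) (dx_v x))
  + integral_circle (fun x =>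
      meshsize N xi x ^+ 2 * enorm (dx_X x) / 6 * dot (dx_dt_X x) (dx_v x))
  + integral_circle (fun x => dot ((2 * pi / Lh) *: perp (dx_X x)) (v x))
  = 0.

Definition semidiscrete_solution phi (X0 : R -> plane R) X : Prop :=
  [/\ forall (j : 'I_N) t, t \in `[0, T] -> time_derivable T (X j) t,
      forall x, x \in `[0, 2 * pi] -> Xh phi X x 0 = interpolant xi phi X0 x
    & forall v, Vh N xi v -> forall t, t \in `[0, T] ->
        weak_formulation phi X v t].

End Semidiscrete.

(* Main.v *)
Require Import Defs.
From mathcomp Require Import all_boot all_order all_algebra.
From mathcomp Require Import all_classical all_reals all_analysis.
From mathcomp Require Import measurable_realfun ring lra zify.
Import Order.TTheory GRing.Theory Num.Theory.
Import numFieldNormedType.Exports.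
Local Open Scope classical_set_scope.
Local Open Scope ring_scope.
Set Implicit Arguments.
Unset Strict Implicit.
Unset Printing Implicit Defensive.

(** The polygon stays convex because its corners obey differential
inequalities of Gronwall type.

Write [e_j] for the edge vectors, [q_j] for their lengths and [D_j] for the
determinant of [e_j] and [e_(j+1)], that is [q_j q_(j+1)] times the sine of the
exterior angle at the vertex [j].  The initial polygon is strictly convex: each
vertex that is not an endpoint of an edge lies strictly to its left
([convex_Npolygon_strict]).  Testing the weak formulation with nodal basis
functions gives the system of ordinary differential equations for the vertices
([weak_formulation_flow]).

Let [t] be the first time at which strict convexity might fail.  Strict
convexity makes every increasing triple of vertices a positively oriented
triangle ([strictly_convex_triple]); in the limit these triangles are still
nonnegatively oriented, so the polygon at [t] is weakly convex, and it is
strictly convex as soon as all [D_j] are positive ([weakly_convex_strict]).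
There are two ways for [D_j] to vanish at [t].
- The exterior angle tends to 0.  Then shortly before [t] the edges [e_j] and
  [e_(j+1)] make an acute angle, and the equations give [D_j' >= - K D_j]
  ([corner_rate]): the neighboring corners push [D_j] up, and everything else
  is proportional to [D_j].  So [D_j] cannot reach 0.
- The exterior angle tends to pi.  Then weak convexity puts all vertices on one
  line and the area is 0 ([flat_area]).  But the signed area [A] satisfies
  [A' >= - K A] ([area_rate]), because every corner triangle has area at most
  [A].  So the area cannot reach 0.

The constants [K] involve only a positive lower bound for the edge lengths,
which exists near [t] by continuity.  Strict convexity is also an open
condition, hence it holds on the whole time interval ([strictly_convex_flow]).
Finally a strictly convex polygon bounds the intersection of the half planes
to the left of its edges ([strictly_convex_Npolygon]). *)

(** * Determinants in the plane *)

Section Planar.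
Context {R : realType}.
Implicit Types p q r u v w : plane R.

Definition det p q : R := p.1 * q.2 - p.2 * q.1.

Lemma dot_perpE p q : dot (perp p) q = det p q.
Proof. by rewrite /dot /perp /det /=; ring. Qed.

Lemma detC p q : det q p = - det p q.
Proof. by rewrite /det; ring. Qed.

Lemma detvv p : det p p = 0.
Proof. by rewrite /det; ring. Qed.

Lemma detDr p q r : det r (p + q) = det r p + det r q.
Proof. by rewrite /det /=; ring. Qed.
Lemma detBl p q r : det (p - q) r = det p r - det q r.
Proof. by rewrite /det /=; ring. Qed.
Lemma detZl c p r : det (c *: p) r = c * det p r.
Proof. by rewrite /det /= /GRing.scale /=; ring. Qed.
Lemma detZr c p r : det r (c *: p) = c * det r p.
Proof. by rewrite /det /= /GRing.scale /=; ring. Qed.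

Lemma dot_ge0 p : 0 <= dot p p.
Proof. by rewrite /dot -!expr2 addr_ge0 ?sqr_ge0. Qed.

Lemma dot_gt0 p : (0 < dot p p) = (p != 0).
Proof.
rewrite lt_def dot_ge0 andbT; congr negb; apply/eqP/eqP => [|->]; last first.
  by rewrite /dot /= mulr0 addr0.
rewrite /dot -!expr2 => /eqP; rewrite paddr_eq0 ?sqr_ge0// !sqrf_eq0.
by case: p => a b /= /andP[/eqP-> /eqP->].
Qed.

Lemma det_eq0_parallel u v : u != 0 -> det u v = 0 ->
  v = (dot u v / dot u u) *: u.
Proof.
rewrite -dot_gt0 => u0 uv0; have un : dot u u != 0 by rewrite gt_eqF.
case: u v uv0 un {u0} => [a b] [c d]; rewrite /det /dot /= => uv0 un.
have h1 : b * (a * d - b * c) = 0 by rewrite uv0 mulr0.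
have h2 : a * (a * d - b * c) = 0 by rewrite uv0 mulr0.
set k := _ / _; have hk : k * (a * a + b * b) = a * c + b * d.
  by rewrite /k divfK.
have h3 : a * (k * (a * a + b * b)) = a * (a * c + b * d) by rewrite hk.
have h4 : b * (k * (a * a + b * b)) = b * (a * c + b * d) by rewrite hk.
by rewrite /GRing.scale /=; congr pair; apply: (mulIf un); rewrite /GRing.scale/=; lra.
Qed.

(** This relation transports signs: if [u] has [a], [b], [c] on its left, then
left turns from [a] to [b] and from [b] to [c] compose. *)
Lemma det_plucker u a b c :
  det u b * det a c = det u a * det b c + det u c * det a b.
Proof. by rewrite /det; ring. Qed.

(** The sine addition formula for the angles from [u] to [v] and from [v] to
[w]. *)
Lemma det_dot_plucker u v w :
  dot v v * det u w = dot u v * det v w + det u v * dot v w.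
Proof. by rewrite /det /dot; ring. Qed.

Lemma dot_det_sqr u v : dot u u * dot v v = dot u v ^+ 2 + det u v ^+ 2.
Proof. by rewrite /det /dot; ring. Qed.

Lemma det_eq0_trans u v w : u != 0 -> det u v = 0 -> det u w = 0 -> det v w = 0.
Proof.
move=> u0 uv uw; rewrite (det_eq0_parallel u0 uv) (det_eq0_parallel u0 uw).
by rewrite detZl detZr detvv !mulr0.
Qed.

End Planar.

(** * Cyclic indices *)

Section CyclicIndices.
Context (N : nat) (N3 : (3 <= N)%N).

Lemma ordS_neq (j : 'I_N) : ordS j != j.
Proof.
apply/eqP => /(congr1 val) /=; have jN := ltn_ord j.
have [h|h] := ltnP j.+1 N; first by rewrite modn_small// => /esym/n_Sn.
have -> : j.+1 = N by apply/eqP; rewrite eqn_leq jN h.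
by rewrite modnn => j0; move: h; rewrite -j0 leqNgt (leq_trans _ N3).
Qed.

Lemma ord_pred_neq (j : 'I_N) : ord_pred j != j.
Proof. by apply/eqP => h; have := ordS_neq (ord_pred j); rewrite ord_predK h eqxx. Qed.

Lemma ordS_neq_pred (j : 'I_N) : ordS j != ord_pred j.
Proof.
apply/eqP => /(congr1 (@ordS N)); rewrite ord_predK => /(congr1 val) /=.
have jN := ltn_ord j; rewrite -addn1 modnDml addn1.
have [h|h] := ltnP j.+2 N; first by rewrite modn_small//; lia.
rewrite -(subnKC h) modnDl modn_small; lia.
Qed.
End CyclicIndices.

(** * Strictly and weakly convex polygons *)

Section ConvexPolygons.
Context {R : realType} (N : nat) (N3 : (3 <= N)%N).
Implicit Types (Y : 'I_N -> plane R) (p : plane R).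

Definition edge Y j := Y j - Y (ord_pred j).

(** Positive to the left of the oriented line through the edge [j]. *)
Definition side Y j p := det (edge Y j) (p - Y j).

(** The product of two consecutive edge lengths and the sine of the exterior
angle between them. *)
Definition corner Y j := det (edge Y j) (edge Y (ordS j)).

Definition strictly_convex Y :=
  forall j k, k != j -> k != ord_pred j -> 0 < side Y j (Y k).

Lemma edgeS Y j : edge Y (ordS j) = Y (ordS j) - Y j.
Proof. by rewrite /edge ordSK. Qed.

Lemma side_pred Y j p : side Y j p = det (edge Y j) (p - Y (ord_pred j)).
Proof.
by rewrite /side /edge /det /=; ring.
Qed.

Lemma sideS Y j p : side Y (ordS j) p = det (edge Y (ordS j)) (p - Y j).
Proof. by rewrite side_pred ordSK. Qed.

Lemma side_ordS Y j : side Y j (Y (ordS j)) = corner Y j.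
Proof. by rewrite /side /corner edgeS. Qed.

Lemma sideS_pred Y j : side Y (ordS j) (Y (ord_pred j)) = corner Y j.
Proof.
by rewrite sideS /corner /edge ordSK /det /=; ring.
Qed.

Lemma side_self Y j : side Y j (Y j) = 0.
Proof. by rewrite /side subrr /det !mulr0 subr0. Qed.

Lemma side_self_pred Y j : side Y j (Y (ord_pred j)) = 0.
Proof. by rewrite side_pred subrr /det !mulr0 subr0. Qed.

Lemma side_selfS Y j : side Y (ordS j) (Y j) = 0.
Proof. by have := side_self_pred Y (ordS j); rewrite ordSK. Qed.

Lemma strictly_convex_side_ge0 Y j k : strictly_convex Y -> 0 <= side Y j (Y k).
Proof.
move=> sY; have [->|kj] := eqVneq k j; first by rewrite side_self.
have [->|kj'] := eqVneq k (ord_pred j); first by rewrite side_self_pred.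
exact/ltW/sY.
Qed.

Lemma strictly_convex_corner Y j : strictly_convex Y -> 0 < corner Y j.
Proof.
by move=> sY; rewrite -side_ordS sY ?(ordS_neq N3)// (ordS_neq_pred N3).
Qed.

(** Two coinciding vertices lie on the lines of all edges at either of them,
so each would be both the predecessor and the successor of the other. *)
Lemma strictly_convex_inj Y : strictly_convex Y -> injective Y.
Proof.
move=> sY a b ab; apply/eqP/negPn/negP => nab.
have hb : b = ord_pred a.
  apply/eqP/negPn/negP => h; have := sY a b; rewrite eq_sym nab h -ab side_self.
  by rewrite ltxx => /(_ isT isT).
have h1 : b != ordS a by rewrite hb eq_sym (ordS_neq_pred N3).
by have := sY _ _ h1; rewrite ordSK eq_sym nab -ab side_selfS ltxx => /(_ isT).
Qed.

Lemma corner_edge_neq0 Y j : corner Y j != 0 -> edge Y j != 0.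
Proof. by apply: contra => /eqP e; rewrite /corner e /det !mul0r subr0. Qed.

(** A vertex [Y k] on the line of a nonadjacent edge would, by the edges next
to that edge, lie strictly inside it; both edges at [Y k], which keep the two
endpoints on their left, would then be parallel to it, and the corner at
[Y k] degenerate. *)
Lemma strictly_convexP Y : (forall j k, 0 <= side Y j (Y k)) ->
  (forall j, 0 < corner Y j) -> injective Y -> strictly_convex Y.
Proof.
move=> sY cY iY j k kj kj'; rewrite lt_def sY andbT; apply/negP => /eqP s0.
have e0 : edge Y j != 0 by rewrite corner_edge_neq0// gt_eqF.
have [r hr] : exists r, Y k - Y j = - r *: edge Y j.
  by eexists (- _); rewrite opprK; exact: det_eq0_parallel e0 s0.
have hr' : Y k - Y (ord_pred j) = (1 - r) *: edge Y j.
  by rewrite scalerBl scale1r -scaleNr -hr /edge [RHS]addrC addrA subrK.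
have r0 : 0 < r.
  rewrite lt_def; apply/andP; split.
    apply: contra kj => /eqP r0; apply/eqP/iY/eqP; rewrite -subr_eq0 hr r0.
    by rewrite oppr0 scale0r.
  have := sY (ordS j) k; rewrite sideS hr detZr detC mulrNN -/(corner Y j).
  by rewrite pmulr_lge0.
have r1 : 0 < 1 - r.
  rewrite lt_def; apply/andP; split.
    apply: contra kj' => /eqP r1; apply/eqP/iY/eqP; rewrite -subr_eq0 hr' r1.
    by rewrite scale0r.
  have := sY (ord_pred j) k; rewrite /side hr' detZr.
  have := cY (ord_pred j); rewrite /corner ord_predK => c0.
  by rewrite pmulr_lge0.
have aux f : 0 <= det f (Y j - Y k) -> 0 <= det f (Y (ord_pred j) - Y k) ->
    det (edge Y j) f = 0.
  rewrite -[Y j - _]opprB hr scaleNr opprK -[_ (ord_pred j) - _]opprB hr'.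
  rewrite -scaleNr !detZr pmulr_rge0// mulNr -mulrN pmulr_rge0// oppr_ge0.
  by rewrite detC => h1 h2; apply/eqP; rewrite -oppr_eq0 eq_le h1 h2.
have := cY k; rewrite /corner (@det_eq0_trans _ (edge Y j)) ?ltxx//.
- by apply: aux; rewrite -/(side Y k _) sY.
- by apply: aux; rewrite -sideS sY.
Qed.

Definition triple Y a b c := det (Y b - Y a) (Y c - Y a).

Lemma triple_cycle Y a b c : triple Y b c a = triple Y a b c.
Proof. by rewrite /triple /det /=; ring. Qed.

(** Seen from [Y a], all later vertices lie on the left of the first edge,
and consecutive ones turn to the left; inside a half plane the sign of the
determinant is a transitive relation, by [det_plucker]. *)
Lemma strictly_convex_triple Y (a b c : 'I_N) : strictly_convex Y ->
  (a < b)%N -> (b < c)%N -> 0 < triple Y a b c.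
Proof.
move=> sY ab.
have ordSval (i : 'I_N) : (i.+1 < N)%N -> ordS i = i.+1 :> nat.
  by move=> iN; rewrite /= modn_small.
have aN : (a.+1 < N)%N by rewrite (leq_ltn_trans ab).
have first (d : 'I_N) : (a.+1 < d)%N -> 0 < det (edge Y (ordS a)) (Y d - Y a).
  move=> ad; rewrite -sideS; apply: sY; rewrite -val_eqE ?ordSK /= ?modn_small//.
    by rewrite gtn_eqF.
  by rewrite gtn_eqF// ltnW.
have step (d : 'I_N) : (a < d)%N -> (d.+1 < N)%N -> 0 < triple Y a d (ordS d).
  move=> ad dN; rewrite -triple_cycle /triple -edgeS -sideS.
  by apply: sY; rewrite ?ordSK -val_eqE /= ?modn_small//; lia.
have [n] := ubnP (c : nat); elim: n c => // n IH c cn bc.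
have c0 : (0 < c)%N by apply: leq_ltn_trans bc.
have hN : (c.-1 < N)%N by rewrite (leq_ltn_trans (leq_pred _)).
pose d := Ordinal hN; have hd : ordS d = c.
  by apply/val_inj; rewrite /= prednK// modn_small.
have [bd|] := ltnP b d; last first.
  rewrite leq_eqVlt => /orP[/eqP /val_inj db|]; last first.
    by rewrite /= -ltnS prednK// ltnS leqNgt bc.
  by rewrite -hd db; apply: step; rewrite // (leq_ltn_trans bc).
have ad := ltn_trans ab bd.
have t1 : 0 < triple Y a b d by apply: IH => //; rewrite /= prednK// -ltnS.
have t2 : 0 < triple Y a d c by rewrite -hd; apply: step; rewrite //= prednK.
have [ab1|] := ltnP a.+1 b; last first.
  move=> h; have -> : b = ordS a by apply/val_inj; rewrite /= modn_small//; lia.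
  by rewrite /triple -edgeS first//= (leq_ltn_trans _ bc).
have f1 := first _ ab1; have f2 := first d (ltn_trans ab1 bd).
have f3 := first c (ltn_trans ab1 bc).
have := det_plucker (edge Y (ordS a)) (Y b - Y a) (Y d - Y a) (Y c - Y a).
rewrite -!/(triple _ _ _ _) => h.
by rewrite -(pmulr_rgt0 _ f2) h addr_gt0// mulr_gt0.
Qed.

Lemma triple_side Y j k : triple Y (ord_pred j) j k = side Y j (Y k).
Proof. by rewrite side_pred. Qed.

(** This condition survives limits of strictly convex polygons; unlike
nonnegativity of [side], it excludes a triangle that is run through twice. *)
Definition weakly_convex Y :=
  forall a b c : 'I_N, (a < b)%N -> (b < c)%N -> 0 <= triple Y a b c.

Lemma ord_pred_val (j : 'I_N) : (0 < j)%N -> ord_pred j = j.-1 :> nat.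
Proof.
move=> j0; rewrite /= addnC -(prednK j0) addnS /= modnDl modn_small//.
by rewrite (leq_ltn_trans (leq_pred _)).
Qed.

Lemma ord_pred_val0 (j : 'I_N) : (j = 0 :> nat)%N -> ord_pred j = N.-1 :> nat.
Proof.
by move=> j0; rewrite /= j0 add0n modn_small// prednK// (leq_trans _ N3).
Qed.

Lemma weakly_convex_side Y j k : weakly_convex Y -> 0 <= side Y j (Y k).
Proof.
move=> wY; have [->|kj] := eqVneq k j; first by rewrite side_self.
have [->|kj'] := eqVneq k (ord_pred j); first by rewrite side_self_pred.
have h1 : nat_of_ord k <> j by move/val_inj/eqP; rewrite (negbTE kj).
have h2 : nat_of_ord k <> ord_pred j by move/val_inj/eqP; rewrite (negbTE kj').
rewrite -triple_side; have kN := ltn_ord k; have jN := ltn_ord j.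
have [j0|j0] := posnP j.
  have hj := ord_pred_val0 j0; rewrite hj in h2.
  by rewrite -triple_cycle; apply: wY; rewrite ?hj; lia.
have hj := ord_pred_val j0; rewrite hj in h2.
have [lkj|ljk] := ltnP k j; last by apply: wY; rewrite ?hj; lia.
by rewrite triple_cycle; apply: wY; rewrite ?hj; lia.
Qed.

(** Two equal vertices [Y a = Y b] make the corner at [b] a triple
[Y a, Y (b - 1), Y (b + 1)] taken in the wrong order. *)
Lemma weakly_convex_inj Y : weakly_convex Y -> (forall j, 0 < corner Y j) ->
  injective Y.
Proof.
move=> wY cY.
suff H (a b : 'I_N) : (a < b)%N -> Y a <> Y b.
  move=> a b; have [ab|ba|/val_inj//] := ltngtP a b; first by move/H: ab.
  by move/esym; move/H: ba.
move=> ab Yab; have bN := ltn_ord b.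
have hp := ord_pred_val (leq_ltn_trans (leq0n a) ab).
have cb : corner Y b = - triple Y a (ord_pred b) (ordS b).
  by rewrite /corner edgeS /edge /triple Yab -opprB /det/=; ring.
have e0 (j : 'I_N) : Y (ord_pred j) <> Y j.
  move=> h; have := corner_edge_neq0 (lt0r_neq0 (cY j)).
  by rewrite /edge h subrr eqxx.
have apb : (a < ord_pred b)%N.
  rewrite hp ltn_neqAle -ltnS prednK ?ab ?andbT ?(leq_ltn_trans _ ab)//.
  apply/eqP => /= h; apply: (e0 b); rewrite -Yab; congr Y; apply/ord_inj.
  by rewrite hp.
have := cY b; rewrite cb oppr_gt0 ltNge => /negP; apply.
have [h|h] := ltnP b.+1 N; first by apply: wY => //; rewrite hp /= modn_small//; lia.
have hS : ordS b = 0 :> nat by rewrite /= (_ : b.+1 = N) ?modnn//; lia.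
have [a0|a0] := posnP a.
  case: (e0 a); rewrite Yab; congr Y; apply/ord_inj; rewrite ord_pred_val0//; lia.
by rewrite triple_cycle; apply: wY; rewrite ?hS// hp; lia.
Qed.

Lemma weakly_convex_strict Y : weakly_convex Y -> (forall j, 0 < corner Y j) ->
  strictly_convex Y.
Proof.
move=> wY cY; apply: strictly_convexP => //; last exact: weakly_convex_inj.
by move=> j k; exact: weakly_convex_side.
Qed.

Lemma strictly_convex_weak Y : strictly_convex Y -> weakly_convex Y.
Proof. by move=> sY a b c ab bc; exact/ltW/strictly_convex_triple. Qed.

Lemma sum_ord_pred (V : nmodType) (f : 'I_N -> V) :
  \sum_(j < N) f (ord_pred j) = \sum_(j < N) f j.
Proof.
rewrite [RHS](reindex (@ord_pred N))//.
by exists (@ordS N) => i _; [exact: ord_predK|exact: ordSK].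
Qed.

(** The terms that depend on the origin [p] cancel around the polygon. *)
Lemma signed_areaE Y p : 2 * signed_area Y = \sum_(j < N) side Y j p.
Proof.
rewrite /signed_area mulrA divff ?pnatr_eq0// mul1r.
have -> : \sum_(j < N) side Y j p = \sum_(j < N) det (Y (ord_pred j)) (Y j) +
    (\sum_(j < N) det (Y j) p - \sum_(j < N) det (Y (ord_pred j)) p).
  rewrite -sumrB -big_split /=; apply: eq_bigr => j _.
  by rewrite /side /edge /det/=; ring.
rewrite (sum_ord_pred (fun j => det (Y j) p)) subrr addr0.
by apply: eq_bigr => j _; rewrite dot_perpE.
Qed.

(** With the next vertex as origin, the area is a sum of nonnegative triangles,
one of which is the triangle of the corner. *)
Lemma corner_le_area Y j : weakly_convex Y -> corner Y j <= 2 * signed_area Y.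
Proof.
move=> wY; rewrite (signed_areaE _ (Y (ordS j))) (bigD1 j)//= side_ordS lerDl.
by apply: sumr_ge0 => k _; exact: weakly_convex_side.
Qed.

Lemma strictly_convex_area Y : strictly_convex Y -> 0 < signed_area Y.
Proof.
move=> sY; have N0 : (0 < N)%N by apply: ltn_trans N3.
have := corner_le_area (Ordinal N0) (strictly_convex_weak sY).
by move=> /(lt_le_trans (strictly_convex_corner _ sY)); rewrite pmulr_rgt0.
Qed.

(** A corner of angle pi confines a weakly convex polygon, which lies on the
left of both of its edges, to a line. *)
Lemma flat_area Y j : weakly_convex Y -> edge Y j != 0 ->
  edge Y (ordS j) != 0 ->
  corner Y j = 0 -> dot (edge Y j) (edge Y (ordS j)) < 0 -> signed_area Y = 0.
Proof.
move=> wY e0 e1 c0 d0.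
have flat k : det (edge Y j) (Y k - Y j) = 0.
  apply: le_anti; rewrite weakly_convex_side// andbT.
  have := weakly_convex_side (ordS j) k wY.
  rewrite sideS (det_eq0_parallel e0 c0) detZl nmulr_rge0//.
  by rewrite pmulr_llt0// invr_gt0 dot_gt0.
have : 2 * signed_area Y = 0.
  rewrite (signed_areaE _ (Y j)) big1// => k _.
  have -> : side Y k (Y j) = det (Y (ord_pred k) - Y j) (Y k - Y j).
    by rewrite /side /edge /det /=; ring.
  exact: det_eq0_trans e0 (flat _) (flat _).
by move/eqP; rewrite mulf_eq0 pnatr_eq0/= => /eqP.
Qed.

End ConvexPolygons.

Lemma ordS_ind (N : nat) (P : 'I_N -> Prop) (i : 'I_N) :
  (forall j, P j -> P (ordS j)) -> P i -> forall j, P j.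
Proof.
move=> PS Pi j; have iN := ltn_ord i; have jN := ltn_ord j.
have -> : j = iter (j + (N - i)) (@ordS N) i.
  have iterE n : nat_of_ord (iter n (@ordS N) i) = ((i + n) %% N)%N.
    elim: n => [|n IH]; first by rewrite addn0 modn_small.
    by rewrite iterS [LHS]/= IH -addn1 modnDml addn1 addnS.
  by apply/ord_inj; rewrite iterE addnCA subnKC ?modnDr ?modn_small// ltnW.
by elim: (j + _)%N => // n IH; rewrite iterS; exact: PS.
Qed.

(** * Convex sets and their boundaries *)

Section ConvexSets.
Context {R : realType}.
Implicit Types (p q r x : plane R) (C : set (plane R)).

Notation is_convex C := (convex_set (C : set (convex_lmodType (plane R)))).

Lemma convex_comb C p q t : is_convex C -> C p -> C q -> 0 <= t -> t <= 1 ->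
  C (t *: p + (1 - t) *: q).
Proof.
move=> cC Cp Cq t0 t1.
by have := cC p q (Itv01 t0 t1) (mem_set Cp) (mem_set Cq); rewrite inE.
Qed.

(** The three barycentric coordinates of [x], up to a common factor, are
positive. *)
Definition inside_triangle x p q r := [/\ 0 < det (q - x) (r - x),
  0 < det (r - x) (p - x) & 0 < det (p - x) (q - x)].

Lemma convex_inside_triangle C x p q r : is_convex C -> C p -> C q -> C r ->
  inside_triangle x p q r -> C x.
Proof.
move=> cC Cp Cq Cr [].
set a := det (q - x) _; set b := det (r - x) _; set c := det (p - x) _.
have e1 : a * p.1 + b * q.1 + c * r.1 = (a + b + c) * x.1.
  by rewrite /a /b /c /det /=; ring.
have e2 : a * p.2 + b * q.2 + c * r.2 = (a + b + c) * x.2.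
  by rewrite /a /b /c /det /=; ring.
move: a b c e1 e2 => a b c e1 e2 a0 b0 c0.
have bc0 : 0 < b + c by rewrite addr_gt0.
have abc0 : 0 < a + b + c by rewrite -addrA addr_gt0.
have t0 : 0 <= b / (b + c) by rewrite divr_ge0// ltW.
have t1 : b / (b + c) <= 1 by rewrite ler_pdivrMr// mul1r lerDl ltW.
have s0 : 0 <= a / (a + b + c) by rewrite divr_ge0// ltW.
have s1 : a / (a + b + c) <= 1 by rewrite ler_pdivrMr// mul1r -addrA lerDl ltW.
have := convex_comb cC Cp (convex_comb cC Cq Cr t0 t1) s0 s1.
congr C; have n1 := lt0r_neq0 bc0; have n2 := lt0r_neq0 abc0.
have aux u v w z : a * u + b * v + c * w = (a + b + c) * z ->
    a / (a + b + c) * u + (1 - a / (a + b + c)) *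
      (b / (b + c) * v + (1 - b / (b + c)) * w) = z.
  move=> h; apply: (mulfI n2); rewrite -h; field.
  by rewrite n1 n2.
by case: x p q r e1 e2 {Cp Cq Cr} => [x1 x2] [p1 p2] [q1 q2] [r1 r2] /= /aux <- /aux <-.
Qed.

Lemma cvg_det (T : Type) (F : set_system T) (f g : T -> plane R) p q :
  Filter F -> f @ F --> p -> g @ F --> q -> det (f z) (g z) @[z --> F] --> det p q.
Proof.
move=> FF fp gq.
have f1 : (f z).1 @[z --> F] --> p.1 by apply: cvg_comp fp _; exact: cvg_fst.
have f2 : (f z).2 @[z --> F] --> p.2 by apply: cvg_comp fp _; exact: cvg_snd.
have g1 : (g z).1 @[z --> F] --> q.1 by apply: cvg_comp gq _; exact: cvg_fst.
have g2 : (g z).2 @[z --> F] --> q.2 by apply: cvg_comp gq _; exact: cvg_snd.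
by apply: cvgB; apply: cvgM.
Qed.

Lemma cvg_dot (T : Type) (F : set_system T) (f g : T -> plane R) p q :
  Filter F -> f @ F --> p -> g @ F --> q -> dot (f z) (g z) @[z --> F] --> dot p q.
Proof.
move=> FF fp gq.
have f1 : (f z).1 @[z --> F] --> p.1 by apply: cvg_comp fp _; exact: cvg_fst.
have f2 : (f z).2 @[z --> F] --> p.2 by apply: cvg_comp fp _; exact: cvg_snd.
have g1 : (g z).1 @[z --> F] --> q.1 by apply: cvg_comp gq _; exact: cvg_fst.
have g2 : (g z).2 @[z --> F] --> q.2 by apply: cvg_comp gq _; exact: cvg_snd.
by apply: cvgD; apply: cvgM.
Qed.

Lemma near_gt0 (T : Type) (F : set_system T) (f : T -> R) (l : R) :
  Filter F -> f @ F --> l -> 0 < l -> \forall z \near F, 0 < f z.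
Proof. by move=> FF fl l0; exact: fl _ (lt_nbhsr l0). Qed.

Lemma near_inside_triangle x p q r : inside_triangle x p q r ->
  \forall z \near (x, (p, (q, r))),
    inside_triangle z.1 z.2.1 z.2.2.1 z.2.2.2.
Proof.
pose T := (plane R * (plane R * (plane R * plane R)))%type.
set z0 : T := (x, (p, (q, r))).
have h1 : (z.1 : plane R) @[z --> z0] --> x by exact: cvg_fst.
have h' : (z.2 : _) @[z --> z0] --> (p, (q, r)) by exact: cvg_snd.
have h2 : (z.2.1 : plane R) @[z --> z0] --> p by apply: cvg_comp h' _; exact: cvg_fst.
have h'' : (z.2.2) @[z --> z0] --> (q, r) by apply: cvg_comp h' _; exact: cvg_snd.
have h3 : (z.2.2.1 : plane R) @[z --> z0] --> q.
  by apply: cvg_comp h'' _; exact: cvg_fst.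
have h4 : (z.2.2.2 : plane R) @[z --> z0] --> r.
  by apply: cvg_comp h'' _; exact: cvg_snd.
move=> [a b c]; near=> z; split; near: z.
- by apply: near_gt0 a; apply: cvg_det; apply: cvgB.
- by apply: near_gt0 b; apply: cvg_det; apply: cvgB.
- by apply: near_gt0 c; apply: cvg_det; apply: cvgB.
Unshelve. all: by end_near. Qed.

(** The vertices may be moved slightly into [C], and the triangle still
surrounds a neighborhood of [x]. *)
Lemma interior_inside_triangle C x p q r : is_convex C ->
  closure C p -> closure C q -> closure C r ->
  inside_triangle x p q r -> interior C x.
Proof.
move=> cC Cp Cq Cr /near_inside_triangle.
case=> -[A B] /= [Ax [[P B'] /= [Pp [[Q S] /= [Qq Sr] sB']]] sB] sAB.
have [p' [Cp' Pp']] := Cp _ Pp; have [q' [Cq' Qq']] := Cq _ Qq.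
have [r' [Cr' Sr']] := Cr _ Sr.
apply: filterS Ax => y Ay; apply: (convex_inside_triangle cC Cp' Cq' Cr').
by apply: (sAB (y, (p', (q', r')))); split => //; apply: sB; split => //; apply: sB'.
Qed.

(** If two points of [closure C] lie strictly on opposite sides of a segment,
the segment has a point strictly inside one of the two triangles that they
form with an endpoint. *)
Lemma boundary_segment_side C p q a b : is_convex C ->
  closure C p -> closure C q -> closure C a -> closure C b ->
  (forall s, 0 < s -> s < 1 -> ~ interior C ((1 - s) *: p + s *: q)) ->
  0 < det (q - p) (a - q) -> 0 <= det (q - p) (b - q).
Proof.
move=> cC Cp Cq Ca Cb nC a0; rewrite leNgt; apply/negP => b0.
pose x s : plane R := (1 - s) *: p + s *: q.
pose g s := det (a - x s) (b - x s).
have gE s t : g s - g t = (s - t) * (det (q - p) (a - q) - det (q - p) (b - q)).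
  by rewrite /g /x /det /= /GRing.scale /=; ring.
have triq s : s < 1 -> 0 < g s -> inside_triangle (x s) q a b.
  move=> s1 gs; split => //.
  - have -> : det (b - x s) (q - x s) = (1 - s) * (- det (q - p) (b - q)).
      by rewrite /x /det /= /GRing.scale /=; ring.
    by rewrite mulr_gt0// ?oppr_gt0// subr_gt0.
  - have -> : det (q - x s) (a - x s) = (1 - s) * det (q - p) (a - q).
      by rewrite /x /det /= /GRing.scale /=; ring.
    by rewrite mulr_gt0// subr_gt0.
have trip s : 0 < s -> g s < 0 -> inside_triangle (x s) p b a.
  move=> s1 gs; split => //.
  - by rewrite detC oppr_gt0.
  - have -> : det (a - x s) (p - x s) = s * det (q - p) (a - q).
      by rewrite /x /det /= /GRing.scale /=; ring.
    by rewrite mulr_gt0.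
  - have -> : det (p - x s) (b - x s) = s * (- det (q - p) (b - q)).
      by rewrite /x /det /= /GRing.scale /=; ring.
    by rewrite mulr_gt0// oppr_gt0.
have h20 : 0 < (2^-1 : R) by rewrite invr_gt0.
have h21 : (2^-1 : R) < 1 by rewrite invf_lt1// ltr1n.
have h30 : 0 < (3^-1 : R) by rewrite invr_gt0.
have h31 : (3^-1 : R) < 1 by rewrite invf_lt1// ltr1n.
have [g2|g2] := ltP 0 (g 2^-1).
  exact: (nC _ h20 h21 (interior_inside_triangle cC Cq Ca Cb (triq _ h21 g2))).
have g3 : g 3^-1 < 0.
  apply: lt_le_trans g2; rewrite -subr_gt0 gE mulr_gt0//.
    by rewrite subr_gt0 ltf_pV2 ?posrE// ltr_nat.
  by rewrite subr_gt0 (lt_trans b0).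
exact: (nC _ h30 h31 (interior_inside_triangle cC Cp Cb Ca (trip _ h30 g3))).
Qed.

Lemma collinear_det0 p q r : det (q - p) (r - q) = 0 -> q - p != 0 ->
  collinear p q r.
Proof.
move=> d0 e0; exists q, (q - p); split=> // x; rewrite !inE => /or3P[]/eqP->.
- by exists (-1); rewrite scaleN1r opprB addrCA subrr addr0.
- by exists 0; rewrite scale0r addr0.
- by exists (dot (q - p) (r - q) / dot (q - p) (q - p));
  rewrite -det_eq0_parallel// addrC subrK.
Qed.

Lemma det0_collinear p q r : collinear p q r -> det (q - p) (r - q) = 0.
Proof.
move=> [a [d [_ h]]].
have [|s ->] := h p; first by rewrite inE eqxx.
have [|t ->] := h q; first by rewrite !inE eqxx orbT.
have [|u ->] := h r; first by rewrite !inE eqxx !orbT.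
by rewrite /det /= /GRing.scale /=; ring.
Qed.

End ConvexSets.

(** * Convex polygons as boundaries of convex sets *)

Section ConvexNpolygons.
Context {R : realType} (N : nat) (N3 : (3 <= N)%N).
Implicit Types (Y : 'I_N -> plane R) (p : plane R).

Lemma edge_in_trace Y j s : 0 <= s -> s <= 1 ->
  polygon_trace Y ((1 - s) *: Y (ord_pred j) + s *: Y j).
Proof. by move=> s0 s1; exists j => //; exists s => //=; rewrite in_itv /= s0 s1. Qed.

Lemma vertex_in_trace Y j : polygon_trace Y (Y j).
Proof.
by have := @edge_in_trace Y j 1 ler01 (lexx 1); rewrite subrr scale0r add0r scale1r.
Qed.

(** The edges lie in the boundary of a convex set, so each edge has all
vertices on one side.  Consecutive edges have the same side, because the two
side conditions share the sign of a corner, and the sign of the area makes it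
the left one. *)
Lemma convex_Npolygon_strict Y : convex_Npolygon Y -> strictly_convex Y.
Proof.
move=> [[[iY aY] nY] [C [cC trC]]].
have clY k : closure C (Y k) by have := vertex_in_trace Y k; rewrite trC => -[].
have c0 j : corner Y j != 0.
  apply/eqP => c0; apply: (nY j); apply: collinear_det0; first by rewrite -edgeS.
  by rewrite subr_eq0; apply/eqP => /iY/eqP; rewrite eq_sym (negbTE (ord_pred_neq N3 j)).
have nint j (s : R) : 0 < s -> s < 1 ->
    ~ interior C ((1 - s) *: Y (ord_pred j) + s *: Y j).
  move=> s0 s1; have := edge_in_trace Y j (ltW s0) (ltW s1).
  by rewrite trC => -[].
have nint' j (s : R) : 0 < s -> s < 1 ->
    ~ interior C ((1 - s) *: Y j + s *: Y (ord_pred j)).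
  move=> s0 s1; rewrite addrC -{1}[s](subKr 1).
  by apply: nint; rewrite ?subr_gt0 ?gtrBl.
have pos j a b : 0 < side Y j (Y a) -> 0 <= side Y j (Y b).
  exact: boundary_segment_side (nint j).
have neg j a b : side Y j (Y a) < 0 -> side Y j (Y b) <= 0.
  have E p : side Y j p = - det (Y (ord_pred j) - Y j) (p - Y (ord_pred j)).
    by rewrite side_pred /edge -opprB -scaleN1r detZl mulN1r.
  rewrite !E oppr_lt0 oppr_le0.
  exact: boundary_segment_side (nint' j).
have same j a : 0 <= corner Y j * side Y j (Y a).
  have := c0 j; rewrite neq_lt => /orP[] cj.
    by rewrite nmulr_rge0//; apply: (neg j (ordS j)); rewrite side_ordS.
  by rewrite pmulr_rge0//; apply: (pos j (ordS j)); rewrite side_ordS.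
have sgS j : (0 < corner Y (ordS j)) = (0 < corner Y j).
  have := same (ordS j) (ord_pred j); rewrite sideS_pred.
  have := c0 j; have := c0 (ordS j); rewrite !neq_lt => /orP[] h1 /orP[] h2.
  - by rewrite (lt_gtF h1) (lt_gtF h2).
  - by rewrite (pmulr_lge0 _ h2) leNgt h1.
  - by rewrite (nmulr_lge0 _ h2) leNgt h1.
  - by rewrite h1 h2.
have [j0 j0pos] : exists j, 0 < corner Y j.
  apply/not_existsP => h; move: aY; apply/negP; rewrite -leNgt.
  pose j1 := Ordinal (ltn_trans (isT : 0 < 2)%N N3).
  rewrite -(pmulr_rle0 _ (ltr0n _ 2)) (signed_areaE _ (Y j1)).
  apply: sumr_le0 => k _; have := same k j1; rewrite nmulr_rge0//.
  by rewrite lt_neqAle c0 leNgt; apply/negP.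
have allpos j : 0 < corner Y j.
  by apply: (ordS_ind (P := fun j => 0 < corner Y j) _ j0pos) => i; rewrite sgS.
apply: strictly_convexP => // j k.
by have := same j k; rewrite pmulr_rge0.
Qed.

Definition left_hull Y : set (plane R) := [set p | forall j, 0 <= side Y j p].

Lemma cvg_side Y j p : side Y j q @[q --> p] --> side Y j p.
Proof.
by apply: cvg_det; [|apply: cvgB]; [exact: cvg_cst|exact: cvg_id|exact: cvg_cst].
Qed.

Lemma side_affine Y j p q s :
  side Y j ((1 - s) *: p + s *: q) = (1 - s) * side Y j p + s * side Y j q.
Proof. by rewrite /side /det /= /GRing.scale /=; ring. Qed.

Lemma left_hull_convex Y : convex_set (left_hull Y : set (convex_lmodType (plane R))).
Proof.
move=> p q s; rewrite !inE => hp hq j.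
have -> : conv s p q =
    (1 - (1 - s%:num)) *: (p : plane R) + (1 - s%:num) *: (q : plane R).
  by rewrite subKr.
rewrite side_affine subKr.
by rewrite addr_ge0// mulr_ge0// subr_ge0.
Qed.

Lemma closure_left_hull Y : closure (left_hull Y) = left_hull Y.
Proof.
apply/seteqP; split; last exact: subset_closure.
move=> p clp j; rewrite leNgt; apply/negP => sj.
have [q [/(_ j) hq]] := clp _ (cvgr_lt _ (@cvg_side Y j p) _ sj).
by rewrite /= ltNge hq.
Qed.

(** A boundary point of [left_hull Y] lies on the line of some edge, and the
two neighboring edges confine it to that edge. *)
Lemma strictly_convex_Npolygon Y : strictly_convex Y -> convex_Npolygon Y.
Proof.
move=> sY; have iY := strictly_convex_inj N3 sY.
have cY j := strictly_convex_corner N3 j sY.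
have eY j : edge Y j != 0 by rewrite corner_edge_neq0// gt_eqF.
split; first split; first by split => //; exact: strictly_convex_area.
  move=> j /det0_collinear; have := cY j.
  by rewrite /corner edgeS => /[swap] ->; rewrite ltxx.
exists (left_hull Y); split; first exact: left_hull_convex.
apply/seteqP; split.
- move=> q [j _ [s /=]]; rewrite in_itv /= => /andP[s0 s1] <-; split.
    rewrite closure_left_hull => i; rewrite side_affine.
    by apply: addr_ge0; apply: mulr_ge0; rewrite ?strictly_convex_side_ge0// subr_ge0.
  set x := _ + _ => intx.
  have cvx : (x - e *: perp (edge Y j)) @[e --> 0^'+] --> x.
    (* [x] moved slightly to the right of its edge leaves the left hull. *)
    rewrite -[X in _ --> X]subr0 -(scale0r (perp (edge Y j))).
    apply: cvgB; first exact: cvg_cst.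
    by apply: cvgZ; [apply: cvg_at_right_filter; exact: cvg_id|exact: cvg_cst].
  have : \forall e \near (0 : R)^'+, 0 < e /\ left_hull Y (x - e *: perp (edge Y j)).
    by apply: filterI; [exact: nbhs_right_gt|exact: cvx _ intx].
  move=> /filter_ex[e [e0 /(_ j)]].
  have -> : side Y j (x - e *: perp (edge Y j)) =
      side Y j x - e * dot (edge Y j) (edge Y j).
    by rewrite /side /det /dot /= /GRing.scale /=; ring.
  rewrite side_affine side_self side_self_pred !mulr0 addr0 sub0r oppr_ge0 leNgt.
  by rewrite mulr_gt0// dot_gt0.
- move=> p []; rewrite closure_left_hull => hp nintp.
  have [j sj] : exists j, side Y j p = 0.
    apply/not_existsP => h; apply: nintp; rewrite /interior /=.
    apply: (@filter_forall _ _ (fun j q => 0 <= side Y j q) (nbhs p)) => j.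
    apply: filterS (near_gt0 _ (@cvg_side Y j p) _) => [q /ltW//|].
    by rewrite lt_def hp andbT; apply/eqP.
  have [r hr] : exists r, p - Y j = r *: edge Y j.
    exists (dot (edge Y j) (p - Y j) / dot (edge Y j) (edge Y j)).
    exact: det_eq0_parallel.
  have hr' : p - Y (ord_pred j) = (1 + r) *: edge Y j.
    by rewrite scalerDl scale1r -hr /edge [RHS]addrC addrA subrK.
  exists j => //; exists (1 + r); last first.
    rewrite -[RHS](subrK (Y (ord_pred j))) hr' /edge scalerBr scalerBl scale1r.
    by rewrite [LHS]addrAC [RHS]addrC addrA.
  rewrite /= in_itv /=; apply/andP; split.
    have := hp (ord_pred j); rewrite /side hr' detZr.
    by have := cY (ord_pred j); rewrite /corner ord_predK => c0; rewrite pmulr_lge0.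
  have := hp (ordS j); rewrite sideS hr detZr detC -/(corner Y j) mulrN oppr_ge0.
  by rewrite pmulr_lle0//; lra.
Qed.

End ConvexNpolygons.

(** * Differential inequalities *)

Section Gronwall.
Context {R : realType}.

(** The product of [expR (K * x)] and [f x] is nondecreasing. *)
Lemma gronwall_gt0 (f df : R -> R) (K a b : R) : a < b ->
  (forall x, x \in `]a, b[ -> is_derive x 1 f (df x)) ->
  {within `[a, b], continuous f} ->
  (forall x, x \in `]a, b[ -> - K * f x <= df x) -> 0 < f a -> 0 < f b.
Proof.
move=> ab df' cf hK fa0; pose g x := expR (K * x) * f x.
have dg x : x \in `]a, b[ -> is_derive x 1 g (expR (K * x) * (df x + K * f x)).
  move=> xab; have h := df' x xab.
  have : is_derive x 1 g (expR (K * x) *: df x + f x *: (expR (K * x) * (K * 1))).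
    apply: is_deriveM; apply: is_derive1_comp.
  by move/is_derive_eq; apply; rewrite /GRing.scale /=; ring.
have cg : {within `[a, b], continuous g}.
  move=> x; apply: cvgM; last exact: cf.
  apply: (@continuous_subspaceT _ _ _ (fun x => expR (K * x))) => y.
  apply: continuous_comp; last exact: continuous_expR.
  by apply: cvgM; [exact: cvg_cst|exact: cvg_id].
suff : g a <= g b.
  move=> gab; have : 0 < g b by apply: lt_le_trans gab; rewrite mulr_gt0 ?expR_gt0.
  by rewrite pmulr_rgt0 ?expR_gt0.
apply: (ger0_derive1_le_cc _ _ cg); rewrite ?in_itv /= ?lexx ?ltW//.
- by move=> x /dg[].
- move=> x xab; rewrite derive1E; have [_ ->] := dg x xab.
  by rewrite mulr_ge0 ?expR_ge0// -lerBlDr sub0r -mulNr hK.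
Qed.

End Gronwall.

Section Velocities.
Context {R : realType}.
Implicit Types (f g : R -> plane R) (t : R).

(** Derivatives are componentwise, so that the product rule for real functions
applies to determinants. *)
Definition has_velocity f t (v : plane R) :=
  is_derive t 1 (fun s => (f s).1 : R) v.1 /\ is_derive t 1 (fun s => (f s).2 : R) v.2.

Lemma has_velocityB f g t u v : has_velocity f t u -> has_velocity g t v ->
  has_velocity (fun s => f s - g s) t (u - v).
Proof. by move=> [f1 f2] [g1 g2]; split; exact: is_deriveB. Qed.

Lemma is_derive_det f g t u v : has_velocity f t u -> has_velocity g t v ->
  is_derive t 1 (fun s => det (f s) (g s)) (det u (g t) + det (f t) v).
Proof.
move=> [f1 f2] [g1 g2].
have := is_deriveB (is_deriveM f1 g2) (is_deriveM f2 g1).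
by move/is_derive_eq; apply; rewrite /det /GRing.scale /=; ring.
Qed.

End Velocities.

(** * Rates of change of the corners and of the area *)

Section FlowRates.
Context {R : realType} (N : nat) (N3 : (3 <= N)%N).
Implicit Types (Y V : 'I_N -> plane R) (m : R).

(** The system of ordinary differential equations for the vertices, equivalent
to the weak formulation. *)
Definition flow_velocity Y V := forall j,
  ((edge_length Y j + edge_length Y (ordS j)) / 2) *: V j =
    (edge_length Y (ordS j))^-1 *: edge Y (ordS j)
    - (edge_length Y j)^-1 *: edge Y j
    - (pi / perimeter Y) *: perp (edge Y j + edge Y (ordS j)).

Lemma edge_length_sqr Y j : edge_length Y j ^+ 2 = dot (edge Y j) (edge Y j).
Proof. by rewrite sqr_sqrtr// dot_ge0. Qed.

Lemma det_flow_velocity Y V j w : flow_velocity Y V ->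
  0 < edge_length Y j -> 0 < edge_length Y (ordS j) ->
  det (V j) w = 2 / (edge_length Y j + edge_length Y (ordS j)) *
   (det (edge Y (ordS j)) w / edge_length Y (ordS j)
    - det (edge Y j) w / edge_length Y j
    + pi / perimeter Y * dot (edge Y j + edge Y (ordS j)) w).
Proof.
move=> /(_ j) hV q0 q1; have s0 := addr_gt0 q0 q1.
apply: (mulfI (lt0r_neq0 (divr_gt0 s0 (ltr0n R 2)))).
rewrite -detZl hV; set p := pi / _.
rewrite mulrA [_ / 2 * _]mulrA divfK ?pnatr_eq0// divff ?gt_eqF// mul1r.
rewrite !detBl !detZl /dot /perp /det /=; ring.
Qed.

Lemma edge_length_le_perimeter Y j : edge_length Y j <= perimeter Y.
Proof.
rewrite /perimeter (bigD1 j)//= lerDl; apply: sumr_ge0 => i _.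
exact: sqrtr_ge0.
Qed.

Lemma dot_le_lengths Y i j :
  `|dot (edge Y i) (edge Y j)| <= edge_length Y i * edge_length Y j.
Proof.
rewrite -ler_sqr ?nnegrE ?mulr_ge0 ?sqrtr_ge0// real_normK ?num_real//.
by rewrite exprMn !edge_length_sqr dot_det_sqr lerDl sqr_ge0.
Qed.

(** For an angle between 0 and pi / 2 the sum of sine and cosine is at least
1. *)
Lemma lengths_le_dot_det Y i j : 0 <= dot (edge Y i) (edge Y j) ->
  0 <= det (edge Y i) (edge Y j) ->
  edge_length Y i * edge_length Y j <=
    dot (edge Y i) (edge Y j) + det (edge Y i) (edge Y j).
Proof.
move=> d0 c0; have q0 : 0 <= edge_length Y i * edge_length Y j.
  by apply: mulr_ge0; exact: sqrtr_ge0.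
have : (edge_length Y i * edge_length Y j) ^+ 2 =
    dot (edge Y i) (edge Y j) ^+ 2 + det (edge Y i) (edge Y j) ^+ 2.
  by rewrite exprMn !edge_length_sqr dot_det_sqr.
move: (dot _ _) (det _ _) (_ * _) d0 c0 q0 => d c q d0 c0 q0 h.
by rewrite -ler_sqr ?nnegrE ?addr_ge0// h sqrrD lerD2r lerDl mulrn_wge0 ?mulr_ge0.
Qed.

(** The motion of the vertex [j] itself changes [corner Y j] through curvature,
which costs a multiple of [corner Y j], and through the forcing term, which is
nonnegative. *)
Lemma velocity_corner_part Y V m j : flow_velocity Y V -> 0 < m ->
  (forall i, m <= edge_length Y i) -> 0 <= corner Y j ->
  det (V j) (edge Y j + edge Y (ordS j)) >=
    - (2 / m ^+ 2) * corner Y j + 2 / (edge_length Y j + edge_length Y (ordS j))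
     * (pi / perimeter Y * dot (edge Y j + edge Y (ordS j)) (edge Y j + edge Y (ordS j))).
Proof.
move=> fV m0 mq c0; have q0 i : 0 < edge_length Y i by apply: lt_le_trans (mq i).
have d1 : det (edge Y (ordS j)) (edge Y j + edge Y (ordS j)) = - corner Y j.
  by rewrite (detDr (edge Y j)) detvv addr0 detC.
have d2 : det (edge Y j) (edge Y j + edge Y (ordS j)) = corner Y j.
  by rewrite (detDr (edge Y j)) detvv add0r.
rewrite (det_flow_velocity _ fV)// d1 d2 [X in _ <= X]mulrDr lerD2r.
set D := corner Y j in c0 *; set q := edge_length Y j; set q' := edge_length _ _.
have hq : m <= q := mq j; have hq' : m <= q' := mq (ordS j).
have i1 : q^-1 <= m^-1 by rewrite lef_pV2 ?posrE ?q0.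
have i2 : q'^-1 <= m^-1 by rewrite lef_pV2 ?posrE ?q0.
have a0 : 0 <= 2 / (q + q') by rewrite divr_ge0 ?addr_ge0 ?ltW ?q0.
have a1 : 2 / (q + q') <= m^-1.
  by rewrite ler_pdivrMr ?addr_gt0 ?q0// ler_pdivlMl//; lra.
have b0 : 0 <= D / q' + D / q by rewrite addr_ge0// divr_ge0// ltW ?q0.
have b1 : D / q' + D / q <= m^-1 * (2 * D).
  have := ler_wpM2l c0 i1; have := ler_wpM2l c0 i2; lra.
rewrite [- D / q']mulNr -opprD mulrN mulNr lerN2.
rewrite (_ : 2 / m ^+ 2 * D = m^-1 * (m^-1 * (2 * D))).
  exact: ler_pM.
by rewrite expr2 invfM; ring.
Qed.

(** The motion of a neighbor of the vertex [j] turns an edge at [j] according to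
the angle between edges that are two apart.  In the sine addition formula for
that angle the term with the neighboring corner is nonnegative, and the other
one is at most proportional to the corner at [j]. *)
Lemma det_skip_forward Y i j k : 0 < edge_length Y j ->
  0 <= dot (edge Y i) (edge Y j) -> 0 <= det (edge Y i) (edge Y j) ->
  0 <= det (edge Y j) (edge Y k) ->
  - (det (edge Y i) (edge Y j) * edge_length Y k) <=
    edge_length Y j * det (edge Y i) (edge Y k).
Proof.
move=> q0 d0 c0 c1; rewrite -(ler_pM2l q0) mulrA -expr2 edge_length_sqr.
rewrite det_dot_plucker.
apply: (@le_trans _ _ (det (edge Y i) (edge Y j) * dot (edge Y j) (edge Y k))).
  rewrite mulrN mulrCA -mulrN ler_wpM2l//.
  by have := dot_le_lengths Y j k; rewrite ler_norml => /andP[].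
by rewrite lerDr mulr_ge0.
Qed.

Lemma det_skip_backward Y i j k : 0 < edge_length Y j ->
  0 <= dot (edge Y j) (edge Y k) -> 0 <= det (edge Y j) (edge Y k) ->
  0 <= det (edge Y i) (edge Y j) ->
  - (det (edge Y j) (edge Y k) * edge_length Y i) <=
    edge_length Y j * det (edge Y i) (edge Y k).
Proof.
move=> q0 d0 c0 c1; rewrite -(ler_pM2l q0) mulrA -expr2 edge_length_sqr.
rewrite det_dot_plucker.
apply: (@le_trans _ _ (dot (edge Y i) (edge Y j) * det (edge Y j) (edge Y k))).
  rewrite mulrN mulrCA -mulrN mulrC ler_wpM2r// mulrC.
  by have := dot_le_lengths Y i j; rewrite ler_norml => /andP[].
by rewrite lerDl mulr_ge0.
Qed.

(** The bound that [corner_rate] needs for either neighbor: [x] and [y] are the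
lengths of the edges at that neighbor, [u] is its curvature part and [z] its
forcing part. *)
Lemma weight_bound (x y m u z c r D : R) : 0 < m -> m <= x -> m <= y ->
  0 <= c -> 0 <= r -> 0 <= D -> u <= 2 * D / m -> z <= r * (x + y) ->
  2 / (x + y) * (u + c * z) <= 2 / m ^+ 2 * D + 2 * c * r.
Proof.
move=> m0 mx my c0 r0 D0 hu hz.
have x0 : 0 < x by apply: lt_le_trans mx.
have y0 : 0 < y by apply: lt_le_trans my.
have xy0 : 0 < x + y by rewrite addr_gt0.
have a0 : 0 <= 2 / (x + y) by rewrite divr_ge0// ltW.
have a1 : 2 / (x + y) <= m^-1 by rewrite ler_pdivrMr// ler_pdivlMl//; lra.
rewrite mulrDr; apply: lerD.
  apply: (@le_trans _ _ (2 / (x + y) * (2 * D / m))); first exact: ler_wpM2l.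
  have -> : 2 / m ^+ 2 * D = m^-1 * (2 * D / m) by rewrite expr2 invfM; ring.
  by rewrite ler_wpM2r// divr_ge0 ?mulr_ge0// ltW.
have -> : 2 * c * r = 2 / (x + y) * (c * (r * (x + y))).
  by rewrite [c * _]mulrA mulrA mulrAC -mulrA [_ / (x + y) * _]mulrC; field; rewrite gt_eqF.
by rewrite ler_wpM2l// ler_wpM2l.
Qed.

Lemma skip_bound (m x y D e : R) : 0 < m -> m <= x -> 0 < y -> 0 <= D ->
  - (D * y) <= x * e -> D / x - e / y <= 2 * D / m.
Proof.
move=> m0 mx y0 D0 h; have x0 : 0 < x by apply: lt_le_trans mx.
have h1 : - (e / y) <= D / x.
  by rewrite -mulNr ler_pdivrMr// mulrAC ler_pdivlMr// mulNr lerNl [e * x]mulrC.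
have h2 : D / x <= D / m by rewrite ler_wpM2l// lef_pV2.
by rewrite -mulrA mulr_natl mulr2n; apply: lerD => //; apply: le_trans h2.
Qed.

(** The forcing terms of the two neighbors are at most [2 c q_j] and
[2 c q_(j+1)] with [c = pi / perimeter Y]; the forcing term of the vertex [j]
compensates their sum up to a multiple of the corner, since for an exterior
angle that tends to 0 the length of [e_j + e_(j+1)] tends to [q_j + q_(j+1)]. *)
Lemma corner_rate Y V m j : flow_velocity Y V -> 0 < m ->
  (forall i, m <= edge_length Y i) -> (forall i, 0 <= corner Y i) ->
  0 <= dot (edge Y j) (edge Y (ordS j)) ->
  - ((6 + 2 * pi) / m ^+ 2) * corner Y j <=
    det (V j - V (ord_pred j)) (edge Y (ordS j)) +
    det (edge Y j) (V (ordS j) - V j).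
Proof.
move=> fV m0 mq c0 d0; have q0 i : 0 < edge_length Y i by apply: lt_le_trans (mq i).
have L0 : 0 < perimeter Y by apply: lt_le_trans (edge_length_le_perimeter Y j).
have cL : 0 <= pi / perimeter Y by rewrite divr_ge0 ?pi_ge0// ltW.
have cm : pi / perimeter Y <= pi / m.
  rewrite ler_wpM2l ?pi_ge0// lef_pV2 ?posrE//.
  exact: le_trans (mq j) (edge_length_le_perimeter Y j).
have T1 := velocity_corner_part fV m0 mq (c0 j).
have T2 : det (V (ordS j)) (edge Y j) <=
    2 / m ^+ 2 * corner Y j + 2 * (pi / perimeter Y) * edge_length Y j.
  rewrite (det_flow_velocity _ fV)//; apply: weight_bound => //; first exact: ltW.
    rewrite [det (edge Y (ordS j)) _]detC [det (edge Y (ordS (ordS j))) _]detC.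
    rewrite !mulNr opprK addrC -/(corner Y j); apply: skip_bound => //.
    exact: (det_skip_forward (q0 (ordS j)) d0 (c0 j) (c0 (ordS j))).
  have h1 := dot_le_lengths Y j (ordS j); have h2 := dot_le_lengths Y j (ordS (ordS j)).
  have -> : dot (edge Y (ordS j) + edge Y (ordS (ordS j))) (edge Y j) =
    dot (edge Y j) (edge Y (ordS j)) + dot (edge Y j) (edge Y (ordS (ordS j))).
    by rewrite /dot /=; ring.
  by rewrite mulrDr; apply: lerD; apply: le_trans (ler_norm _) _.
have T3 : det (V (ord_pred j)) (edge Y (ordS j)) <=
    2 / m ^+ 2 * corner Y j + 2 * (pi / perimeter Y) * edge_length Y (ordS j).
  have cp : corner Y (ord_pred j) = det (edge Y (ord_pred j)) (edge Y j).
    by rewrite /corner ord_predK.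
  have fp := det_flow_velocity (edge Y (ordS j)) fV (q0 (ord_pred j)).
  rewrite ord_predK in fp; rewrite fp//.
  apply: weight_bound => //; first exact: ltW.
    rewrite -/(corner Y j); apply: skip_bound => //.
    by apply: (det_skip_backward (q0 j) d0 (c0 j)); rewrite -cp.
  have h1 := dot_le_lengths Y j (ordS j).
  have h2 := dot_le_lengths Y (ord_pred j) (ordS j).
  have -> : dot (edge Y (ord_pred j) + edge Y j) (edge Y (ordS j)) =
    dot (edge Y (ord_pred j)) (edge Y (ordS j)) + dot (edge Y j) (edge Y (ordS j)).
    by rewrite /dot /=; ring.
  by rewrite mulrC mulrDl; apply: lerD; apply: le_trans (ler_norm _) _.
have split_rate : det (V j - V (ord_pred j)) (edge Y (ordS j)) +
    det (edge Y j) (V (ordS j) - V j) =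
    det (V j) (edge Y j + edge Y (ordS j)) - det (V (ord_pred j)) (edge Y (ordS j)) -
    det (V (ordS j)) (edge Y j).
  by rewrite /det /=; ring.
have hlen : (edge_length Y j + edge_length Y (ordS j)) ^+ 2 - 2 * corner Y j <=
    dot (edge Y j + edge Y (ordS j)) (edge Y j + edge Y (ordS j)).
  have -> : dot (edge Y j + edge Y (ordS j)) (edge Y j + edge Y (ordS j)) =
    edge_length Y j ^+ 2 + edge_length Y (ordS j) ^+ 2 +
    2 * dot (edge Y j) (edge Y (ordS j)).
    by rewrite !edge_length_sqr /dot /=; ring.
  have := lengths_le_dot_det d0 (c0 j); rewrite -/(corner Y j).
  by rewrite sqrrD; lra.
have x0 := q0 j; have y0 := q0 (ordS j); have mx := mq j; have my := mq (ordS j).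
have D0 := c0 j.
rewrite split_rate; move: T1 T2 T3 hlen x0 y0 mx my D0.
move: (corner Y j) (edge_length Y j) (edge_length Y (ordS j)) (dot (_ + _) (_ + _)).
move: (det (V j) _) (det (V (ord_pred j)) _) (det (V (ordS j)) _).
move: (pi / perimeter Y) cL cm => c cL cm t1 t2 t3 D x y s T1 T2 T3 hs x0 y0 mx my D0.
have xy0 : 0 < x + y by rewrite addr_gt0.
have a1 : 2 / (x + y) <= m^-1 by rewrite ler_pdivrMr// ler_pdivlMl//; lra.
have a0 : 0 <= 2 / (x + y) by rewrite divr_ge0// ltW.
have h1 : 2 / (x + y) * (c * ((x + y) ^+ 2 - 2 * D)) <= 2 / (x + y) * (c * s).
  by rewrite ler_wpM2l// ler_wpM2l.
have e1 : 2 / (x + y) * (c * ((x + y) ^+ 2 - 2 * D)) =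
    2 * c * (x + y) - 2 / (x + y) * c * (2 * D).
  by field; rewrite gt_eqF.
have h2 : 2 / (x + y) * c * (2 * D) <= m^-1 * (pi / m) * (2 * D).
  by apply: ler_wpM2r; [rewrite mulr_ge0|exact: ler_pM].
have e2 : (6 + 2 * pi) / m ^+ 2 * D = 3 * (2 / m ^+ 2 * D) + m^-1 * (pi / m) * (2 * D).
  by field; rewrite gt_eqF.
rewrite mulNr e2; rewrite mulNr in T1; lra.
Qed.

(** The derivative of twice the signed area. *)
Definition area_velocity Y V := \sum_(j < N) det (V j) (edge Y j + edge Y (ordS j)).

Lemma area_rate Y V m : flow_velocity Y V -> 0 < m ->
  (forall i, m <= edge_length Y i) -> (forall i, 0 <= corner Y i) ->
  weakly_convex Y ->
  - (N%:R * (2 / m ^+ 2)) * (2 * signed_area Y) <= area_velocity Y V.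
Proof.
move=> fV m0 mq c0 wY; have m20 : 0 <= 2 / m ^+ 2 by rewrite divr_ge0// exprn_ge0// ltW.
have -> : - (N%:R * (2 / m ^+ 2)) * (2 * signed_area Y) =
    \sum_(j < N) - (2 / m ^+ 2) * (2 * signed_area Y).
  by rewrite sumr_const card_ord -[RHS]mulr_natl !mulNr mulrN -mulrA.
apply: ler_sum => j _; have h := velocity_corner_part fV m0 mq (c0 j).
apply: le_trans h; have q0 i : 0 < edge_length Y i by apply: lt_le_trans (mq i).
apply: (@le_trans _ _ (- (2 / m ^+ 2) * corner Y j)).
  by rewrite ler_wnM2l ?oppr_le0// corner_le_area.
rewrite lerDl; apply: mulr_ge0; last apply: mulr_ge0; last exact: dot_ge0.
  by rewrite divr_ge0// addr_ge0// ltW.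
rewrite divr_ge0 ?pi_ge0// ltW//.
exact: lt_le_trans (edge_length_le_perimeter Y j).
Qed.

End FlowRates.

(** * Propagation of strict convexity in time *)

(** The supremum of the times up to which [P] holds is [T]. *)
Lemma real_induction (R : realType) (P : R -> Prop) (T : R) : P 0 ->
  (forall t, 0 < t -> t <= T -> (forall s, 0 <= s -> s < t -> P s) -> P t) ->
  (forall t, 0 <= t -> t < T -> P t -> \forall s \near t, P s) ->
  forall t, 0 <= t -> t <= T -> P t.
Proof.
move=> P0 Pleft Popen t t0 tT; have T0 := le_trans t0 tT.
pose G := [set u | [/\ 0 <= u, u <= T & forall s, 0 <= s -> s <= u -> P s]].
have G0 : G 0.
  split=> // s s0 s0'; suff -> : s = 0 by [].
  by apply/eqP; rewrite eq_le s0 s0'.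
have hG : has_sup G by split; [exists 0|exists T => u []].
pose u := sup G.
have u0 : 0 <= u by apply: ub_le_sup G0; case: hG.
have uT : u <= T by apply: ge_sup; [exists 0|move=> v []].
have below s : 0 <= s -> s < u -> P s.
  move=> s0 su; have e0 : 0 < u - s by rewrite subr_gt0.
  have [g [_ _ Pg]] := sup_adherent e0 hG.
  by rewrite opprB addrC subrK => sg; apply: Pg => //; exact: ltW.
have Pu : P u.
  by move: u0; rewrite le_eqVlt => /predU1P[<-//|u0]; exact: Pleft.
have upto s : 0 <= s -> s <= u -> P s.
  by move=> s0; rewrite le_eqVlt => /predU1P[->//|]; exact: below.
have [Tu|uT'] := leP T u; first by apply: upto => //; exact: le_trans Tu.
have /nbhs_ballP[d /= d0 dP] := Popen u u0 uT' Pu.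
pose v := Num.min T (u + d / 2).
have uv : u < v by rewrite lt_min uT' ltrDl divr_gt0.
suff : G v by move=> /(ub_le_sup (proj2 hG)); rewrite leNgt uv.
split; [exact: le_trans (ltW uv)|by rewrite ge_min lexx|].
move=> s s0; rewrite le_min => /andP[_ sv]; have [su|us] := leP s u; first exact: upto.
apply: dP; rewrite /ball /= ler0_norm ?subr_le0 ?ltW// opprB ltrBlDl.
by rewrite (le_lt_trans sv)// ltrD2l; lra.
Qed.

Section Evolution.
Context {R : realType} (N : nat) (N3 : (3 <= N)%N) (T : R).
Context (Y V : R -> 'I_N -> plane R).
Context (cY : forall j, continuous (fun t => Y t j)).
Context (dY : forall t : R, t \in `]0, T[ -> forall j,
  has_velocity (fun s => Y s j) t (V t j)).
Context (fY : forall t : R, t \in `]0, T[ -> flow_velocity (Y t) (V t)).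
Context (qY : forall t : R, t \in `[0, T] -> forall j, 0 < edge_length (Y t) j).

Lemma continuous_edge j : continuous (fun t => edge (Y t) j).
Proof. by move=> t; apply: cvgB; exact: cY. Qed.

Lemma continuous_corner j : continuous (fun t => corner (Y t) j : R).
Proof. by move=> t; apply: cvg_det; exact: continuous_edge. Qed.

Lemma continuous_edge_length j : continuous (fun t => edge_length (Y t) j : R).
Proof.
move=> t; apply: (@continuous_comp _ _ _ (fun t => dot (edge (Y t) j) (edge (Y t) j))).
  by apply: cvg_dot; exact: continuous_edge.
exact: sqrt_continuous.
Qed.

Lemma signed_area_det : (fun t => 2 * signed_area (Y t)) =
  \sum_(j < N) (fun t => det (Y t (ord_pred j)) (Y t j)).
Proof.
apply/funext => t; rewrite fct_sumE /signed_area mulrA divff ?pnatr_eq0// mul1r.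
by apply: eq_bigr => j _; rewrite dot_perpE.
Qed.

Lemma continuous_area : continuous (fun t => 2 * signed_area (Y t) : R).
Proof.
rewrite signed_area_det => t; rewrite fct_sumE.
apply: cvg_big => [|j _].
  by move=> x; exact: add_continuous.
by apply: cvg_det; exact: cY.
Qed.

Lemma is_derive_corner (t : R) j : t \in `]0, T[ ->
  is_derive t 1 (fun s => corner (Y s) j)
    (det (V t j - V t (ord_pred j)) (edge (Y t) (ordS j)) +
     det (edge (Y t) j) (V t (ordS j) - V t j)).
Proof.
move=> tT; have dS := has_velocityB (dY tT (ordS j)) (dY tT j).
have d0 := has_velocityB (dY tT j) (dY tT (ord_pred j)).
have := is_derive_det d0 dS; rewrite -!edgeS.
by apply: near_eq_is_derive; near=> s; rewrite /corner edgeS.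
Unshelve. all: by end_near. Qed.

Lemma is_derive_area (t : R) : t \in `]0, T[ ->
  is_derive t 1 (fun s => 2 * signed_area (Y s)) (area_velocity (Y t) (V t)).
Proof.
move=> tT; rewrite signed_area_det.
have := is_derive_sum (fun j => is_derive_det (dY tT (ord_pred j)) (dY tT j)).
move=> /is_derive_eq; apply; rewrite /area_velocity big_split /=.
have -> : \sum_(j < N) det (V t (ord_pred j)) (Y t j) =
    \sum_(j < N) det (V t j) (Y t (ordS j)).
  rewrite -(sum_ord_pred (fun j => det (V t j) (Y t (ordS j)))).
  by apply: eq_bigr => j _; rewrite ord_predK.
rewrite -big_split /=; apply: eq_bigr => j _.
by rewrite edgeS /edge /det /=; ring.
Qed.

Lemma itvoo_sub (a b t : R) : 0 <= a -> b <= T -> t \in `]a, b[ -> t \in `]0, T[.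
Proof.
move=> a0 bT; rewrite !in_itv /= => /andP[at_ tb].
by rewrite (le_lt_trans a0)//= (lt_le_trans tb).
Qed.

Lemma weakly_convex_left_limit (t : R) : 0 < t ->
  (forall s : R, 0 <= s -> s < t -> strictly_convex (Y s)) -> weakly_convex (Y t).
Proof.
move=> t0 sY a b c ab bc; rewrite leNgt; apply/negP => neg.
have ct : triple (Y s) a b c @[s --> t] --> triple (Y t) a b c.
  by apply: cvg_det; apply: cvgB; exact: cY.
have H : \forall s \near t^'-, triple (Y s) a b c < 0 /\ (0 < s /\ s < t).
  apply: filterI; last by apply: filterI; [exact: nbhs_left_gt|exact: nbhs_left_lt].
  exact: (cvgr_lt _ (cvg_at_left_filter ct) _ neg).
have [s [sneg [s0 st]]] := @filter_ex _ _ (at_left_proper_filter t) _ H.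
move: sneg; rewrite ltNge => /negP; apply.
have sYs := sY s (ltW s0) st.
by apply: (strictly_convex_weak _ sYs).
Qed.

(** On a short interval before [t] the edge lengths stay away from zero, so
that the corner rates and the area rate give Gronwall inequalities there.
Hence a corner can vanish at [t] only if its edges are antiparallel, which the
positive area forbids. *)
Lemma strictly_convex_left_limit (t : R) : 0 < t -> t <= T ->
  (forall s : R, 0 <= s -> s < t -> strictly_convex (Y s)) -> strictly_convex (Y t).
Proof.
move=> t0 tT sY; have wY := weakly_convex_left_limit t0 sY.
have tin : t \in `[0, T] by rewrite in_itv /= tT ltW.
(* [m] is a common lower bound of the edge lengths near [t]. *)
have /filter_ex[m [m0 mq]] : \forall m \near (0 : R)^'+,
    0 < m /\ forall j, m < edge_length (Y t) j.
  apply: filterI; first exact: nbhs_right_gt.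
  apply: (@filter_forall _ _ (fun j m => m < edge_length (Y t) j) 0^'+) => j.
  by apply: nbhs_right_lt; exact: qY.
pose d j s := dot (edge (Y s) j) (edge (Y s) (ordS j)).
have /nbhs_ballP[e /= e0 he] : \forall s \near t, forall j,
    m < edge_length (Y s) j /\ (0 < d j t -> 0 < d j s).
  apply: (@filter_forall _ _ (fun j s => m < edge_length (Y s) j /\
    (0 < d j t -> 0 < d j s)) (nbhs t)) => j.
  apply: filterI; first exact: cvgr_gt (@continuous_edge_length j t) _ (mq j).
  have [dj|dj] := ltP 0 (d j t); last first.
    by apply: (@filterE _ (nbhs t)).
  have cd : d j s @[s --> t] --> d j t by apply: cvg_dot; exact: continuous_edge.
  by apply: filterS (near_gt0 _ cd dj) => s.
(* Any positive [a] before [t] and closer to it than [e] would do. *)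
pose a := Num.max (t / 2) (t - e / 2).
have a0 : 0 < a by rewrite lt_max divr_gt0.
have at_ : a < t by rewrite gt_max; apply/andP; split; lra.
have near_t s : s \in `]a, t[ -> forall j,
    m < edge_length (Y s) j /\ (0 < d j t -> 0 < d j s).
  rewrite in_itv /= gt_max => /andP[/andP[_ es] st]; apply: he.
  by rewrite /ball /= gtr0_norm; lra.
have sYs s : s \in `]a, t[ -> strictly_convex (Y s).
  by rewrite in_itv /= => /andP[as_ st]; apply: sY => //; apply: ltW; exact: lt_trans as_.
have sT s : s \in `]a, t[ -> s \in `]0, T[ by apply: itvoo_sub => //; exact: ltW.
have sYa : strictly_convex (Y a) by apply: sY => //; exact: ltW.
have corner_pos j : 0 < d j t -> 0 < corner (Y t) j.
  move=> dj; apply: (gronwall_gt0 at_ (fun s h => is_derive_corner j (sT s h))).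
  - by apply: continuous_subspaceT; exact: continuous_corner.
  - move=> s sat; apply: (corner_rate (fY (sT s sat)) m0).
    + by move=> i; have [/ltW] := near_t s sat i.
    + by move=> i; apply/ltW/(strictly_convex_corner N3); exact: sYs.
    + by apply: ltW; have [_] := near_t s sat j; exact.
  - exact: strictly_convex_corner.
have area_pos : 0 < 2 * signed_area (Y t).
  apply: (gronwall_gt0 at_ (fun s h => is_derive_area (sT s h))).
  - by apply: continuous_subspaceT; exact: continuous_area.
  - move=> s sat; apply: (area_rate N3 (fY (sT s sat)) m0).
    + by move=> i; have [/ltW] := near_t s sat i.
    + by move=> i; apply/ltW/(strictly_convex_corner N3); exact: sYs.
    + exact/strictly_convex_weak/sYs.
  - by rewrite mulr_gt0// (strictly_convex_area N3).
have e_neq0 j : edge (Y t) j != 0.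
  apply/eqP => h; have := qY tin j; rewrite /edge_length -/(edge (Y t) j) h.
  by rewrite /enorm /dot /= !mulr0 addr0 sqrtr0 ltxx.
apply: (weakly_convex_strict N3 wY) => j; rewrite lt_def -{2}side_ordS.
rewrite (weakly_convex_side N3)// andbT; apply/negP => /eqP c0.
have [dj|] := ltP 0 (d j t); first by have := corner_pos j dj; rewrite c0 ltxx.
rewrite le_eqVlt => /predU1P[dj|dj]; last first.
  have := flat_area N3 wY (e_neq0 j) (e_neq0 (ordS j)) c0 dj.
  by move=> A0; move: area_pos; rewrite A0 mulr0 ltxx.
have := dot_det_sqr (edge (Y t) j) (edge (Y t) (ordS j)).
rewrite -/(d j t) dj -/(corner (Y t) j) c0 expr0n addr0 => /eqP.
by rewrite mulf_eq0 !gt_eqF// dot_gt0.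
Qed.

Lemma near_strictly_convex (t : R) : strictly_convex (Y t) ->
  \forall s \near t, strictly_convex (Y s).
Proof.
move=> sY; apply: (@filter_forall _ _ (fun j s => forall k, k != j ->
  k != ord_pred j -> 0 < side (Y s) j (Y s k)) (nbhs t)) => j.
apply: (@filter_forall _ _ (fun k s => k != j ->
  k != ord_pred j -> 0 < side (Y s) j (Y s k)) (nbhs t)) => k.
have [kj|kj] := boolP ((k != j) && (k != ord_pred j)); last first.
  by apply: (@filterE _ (nbhs t)) => s k1 k2; move: kj; rewrite k1 k2.
have /andP[k1 k2] := kj.
have cs : side (Y s) j (Y s k) @[s --> t] --> side (Y t) j (Y t k).
  apply: cvg_det; first exact: continuous_edge.
  by apply: cvgB; exact: cY.
by apply: filterS (near_gt0 _ cs (sY j k k1 k2)) => s.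
Qed.

Lemma strictly_convex_flow : strictly_convex (Y 0) ->
  forall t : R, 0 <= t -> t <= T -> strictly_convex (Y t).
Proof.
move=> sY0; apply: real_induction => // [t t0 tT sY|t t0 tT].
  exact: strictly_convex_left_limit.
exact: near_strictly_convex.
Qed.

End Evolution.

(** * Integrals over the partitioned circle *)

Section PiecewiseIntegral.
Context {R : realType}.
Local Notation mu := (@lebesgue_measure R).

Definition lerp (u v s : R) : R := (1 - s) * u + s * v.

(** In the affine coordinate of an interval, all integrands of the weak
formulation are products of two affine functions; these weights integrate such
a product exactly. *)
Lemma integral_lerp_piece (f : R -> R) (a b u0 u1 v0 v1 : R) : a < b ->
  (forall x, x \in `]a, b[ -> f x =
     lerp u0 u1 ((x - a) / (b - a)) * lerp v0 v1 ((x - a) / (b - a))) ->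
  measurable_fun `]a, b[ f /\
  (\int[mu]_(x in `]a, b[) (f x)%:E)%E =
   ((b - a) * (u0 * v0 / 3 + (u0 * v1 + u1 * v0) / 6 + u1 * v1 / 3))%:E.
Proof.
move=> ab hf; have h0 : b - a != 0 by rewrite gt_eqF// subr_gt0.
pose S (x : R) : R := (x - a) / (b - a).
pose g x := lerp u0 u1 (S x) * lerp v0 v1 (S x).
(* [c0 + c1 S + c2 S ^ 2] is the product of the two affine functions. *)
pose c0 := u0 * v0; pose c1 := u0 * (v1 - v0) + (u1 - u0) * v0.
pose c2 := (u1 - u0) * (v1 - v0).
pose G : R -> R := (b - a) *: (c0 *: S + (c1 / 2) *: (S ^+ 2) + (c2 / 3) *: (S ^+ 3)).
have dS (x : R) : is_derive x 1 S (b - a)^-1.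
  have : is_derive x 1 ((b - a)^-1 *: (id - cst a)) ((b - a)^-1 *: (1 - 0)).
    by apply: is_deriveZ; apply: is_deriveB.
  rewrite subr0 => /is_derive_eq h.
  have -> : S = (b - a)^-1 *: (id - cst a) by apply/funext => y; rewrite /S mulrC.
  by apply: h; rewrite /GRing.scale /= mulr1.
have dG (x : R) : is_derive x 1 G (g x).
  have := is_deriveZ (b - a) (is_deriveD (is_deriveD (is_deriveZ c0 (dS x))
    (is_deriveZ (c1 / 2) (is_deriveX 2 (dS x))))
    (is_deriveZ (c2 / 3) (is_deriveX 3 (dS x)))).
  move=> /is_derive_eq; apply.
  by rewrite /g /c0 /c1 /c2 /lerp /GRing.scale /=; field.
have cG : continuous G.
  by move=> x; apply: differentiable_continuous; apply/derivable1_diffP; have [] := dG x.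
have cS : continuous S.
  by move=> x; apply: differentiable_continuous; apply/derivable1_diffP; have [] := dS x.
have clerp u v : continuous (fun x => lerp u v (S x)).
  move=> x; apply: cvgD; apply: cvgM; [apply: cvgB|exact: cvg_cst|exact: cS|exact: cvg_cst].
    exact: cvg_cst.
  exact: cS.
have cg : continuous g by move=> x; apply: cvgM; exact: clerp.
have eqfg : {in `]a, b[%classic, g =1 f} by move=> x; rewrite inE => /hf ->.
have mf : measurable_fun `]a, b[ f.
  apply: eq_measurable_fun eqfg _.
  by apply: measurable_funS (continuous_measurable_fun cg).
split=> //.
transitivity (\int[mu]_(x in `]a, b[) (g x)%:E)%E.
  by apply: eq_integral => x xab; rewrite eqfg.
rewrite -(@integral_itv_bndoo _ _ _ _ true false).
  rewrite (@continuous_FTC2 _ g G)//.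
  - have GE x : G x = (b - a) * (c0 * S x + c1 / 2 * S x ^+ 2 + c2 / 3 * S x ^+ 3).
      by [].
    have Sa : S a = 0 by rewrite /S subrr mul0r.
    have Sb : S b = 1 by rewrite /S divff.
    by rewrite -EFinB !GE Sa Sb /c0 /c1 /c2; congr EFin; field.
  - by apply: continuous_subspaceT.
  - split.
    + by move=> x _; have [] := dG x.
    + by apply: cvg_at_right_filter; exact: cG.
    + by apply: cvg_at_left_filter; exact: cG.
  - by move=> x _; rewrite derive1E; have [_] := dG x.
apply/measurable_EFinP.
by apply: measurable_funS (continuous_measurable_fun cg).
Qed.

Lemma partition_monotone (N : nat) (xi : nat -> R) (m n : nat) :
  partition_of_circle N xi -> (m <= n)%N -> (n <= N)%N -> xi m <= xi n.
Proof.
move=> [_ _ hxi]; elim: n => [|n IH]; first by rewrite leqn0 => /eqP->.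
rewrite leq_eqVlt => /predU1P[->//|mn nN].
by rewrite (le_trans (IH mn (ltnW nN)))// ltW// hxi.
Qed.

Lemma integral_circle_pieces (N : nat) (xi : nat -> R) (f : R -> R) (w : 'I_N -> R) :
  partition_of_circle N xi ->
  (forall k : 'I_N, measurable_fun `]xi k, xi k.+1[ f /\
    (\int[mu]_(x in `]xi k, xi k.+1[) (f x)%:E)%E = (w k)%:E) ->
  integral_circle f = \sum_(k < N) w k.
Proof.
move=> pxi hf; have [xi0 xiN xilt] := pxi.
pose w' n := oapp w 0 (insub n).
have w'E (k : 'I_N) : w' k = w k by rewrite /w' valK.
have main n : (n <= N)%N -> measurable_fun `[xi 0%N, xi n] f /\
    (\int[mu]_(x in `[xi 0%N, xi n]) (f x)%:E)%E = (\sum_(0 <= k < n) w' k)%:E.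
  elim: n => [_|n IH nN].
    by rewrite set_itv1 big_nil integral_set1; split => //; exact: measurable_fun_set1.
  have [mf If] := IH (ltnW nN).
  have [mp Ip] := hf (Ordinal nN).
  have mp' : measurable_fun `]xi n, xi n.+1] f.
    exact/measurable_fun_itv_bndo_bndcP.
  have le0 : (BLeft (xi 0%N) <= BRight (xi n))%O.
    by rewrite bnd_simp (partition_monotone pxi)// ltnW.
  have le1 : (BRight (xi n) <= BRight (xi n.+1))%O by rewrite bnd_simp ltW// xilt.
  rewrite (itv_bndbnd_setU le0 le1).
  have mU : measurable_fun (`[xi 0%N, xi n] `|` `]xi n, xi n.+1]) f.
    by apply/measurable_funU.
  split => //; rewrite integral_setU//.
  - rewrite If (integral_itv_bndoo _ (x := xi n) (y := xi n.+1)).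
      by rewrite Ip big_nat_recr//= EFinD (w'E (Ordinal nN)).
    exact/measurable_EFinP.
  - exact/measurable_EFinP.
  - apply/disj_setPS => x [] /=; rewrite !in_itv /= => /andP[_ xn] /andP[nx _].
    by have := lt_le_trans nx xn; rewrite ltxx.
have [_ h] := main N (leqnn N).
rewrite xi0 xiN in h; rewrite /integral_circle /Rintegral h /= big_mkord.
by apply: eq_bigr => k _; exact: w'E.
Qed.

End PiecewiseIntegral.

(** * Finite element functions on one interval *)

Section LocalForm.
Context {R : realType} (N : nat) (xi : nat -> R).
Context (pxi : partition_of_circle N xi) (phi : 'I_N -> R -> R).
Context (hphi : nodal_basis xi phi).

(** The interval from [xi k] to [xi k.+1] joins the nodes [k] and [ordS k], and
it carries the edge with index [ordS k]. *)
Definition mesh (k : 'I_N) := xi k.+1 - xi k.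
Definition local (k : 'I_N) (x : R) := (x - xi k) / mesh k.

Lemma mesh_gt0 k : 0 < mesh k.
Proof. by have [_ _ h] := pxi; rewrite subr_gt0 h. Qed.

Lemma integral_circle_lerp (f : R -> R) (u0 u1 v0 v1 : 'I_N -> R) :
  (forall (k : 'I_N) x, x \in `]xi k, xi k.+1[ ->
    f x = lerp (u0 k) (u1 k) (local k x) * lerp (v0 k) (v1 k) (local k x)) ->
  integral_circle f = \sum_(k < N) mesh k *
    (u0 k * v0 k / 3 + (u0 k * v1 k + u1 k * v0 k) / 6 + u1 k * v1 k / 3).
Proof.
move=> hf; apply: (integral_circle_pieces pxi) => k.
by apply: integral_lerp_piece; [rewrite -subr_gt0 mesh_gt0|exact: hf].
Qed.

(** The value at the right end of the last interval comes from periodicity. *)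
Lemma nodal_basisE (k j : 'I_N) x : xi k <= x -> x <= xi k.+1 ->
  phi j x = lerp (k == j)%:R (ordS k == j)%:R (local k x).
Proof.
move=> kx xk; have [[[_ per] aff] node] := hphi j.
have [a [b ab]] := aff k (ltn_ord k).
have nk : phi j (xi k) = (k == j)%:R by exact: node.
have nk1 : phi j (xi k.+1) = (ordS k == j)%:R.
  have [kN|Nk] := ltnP k.+1 N.
    by rewrite -node /= modn_small.
  have [xi0 xiN _] := pxi; have eN : k.+1 = N by apply/eqP; rewrite eqn_leq Nk ltn_ord.
  by rewrite -node /= eN modnn xi0 xiN per.
have m0 := mesh_gt0 k; have k0 : xi k <= xi k.+1 by rewrite -subr_ge0 ltW.
move: nk nk1; rewrite !ab ?in_itv /= ?lexx ?kx ?xk ?k0// => <- <-.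
have := lt0r_neq0 m0; rewrite /lerp /local /mesh /GRing.scale /= => mn0.
by field.
Qed.

Lemma sum_nodal_basis (F : 'I_N -> plane R) (k : 'I_N) x :
  xi k <= x -> x <= xi k.+1 ->
  \sum_(j < N) phi j x *: F j = (1 - local k x) *: F k + local k x *: F (ordS k).
Proof.
move=> kx xk.
transitivity (\sum_(j < N) (((1 - local k x) * (k == j)%:R) *: F j +
                            (local k x * (ordS k == j)%:R) *: F j)).
  by apply: eq_bigr => j _; rewrite (nodal_basisE j kx xk) scalerDl.
rewrite big_split /= (bigD1 k)//= eqxx mulr1 big1 ?addr0; last first.
  by move=> i /negbTE ik; rewrite eq_sym ik mulr0 scale0r.
rewrite (bigD1 (ordS k))//= eqxx mulr1 big1 ?addr0//.
by move=> i /negbTE ik; rewrite eq_sym ik mulr0 scale0r.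
Qed.

Lemma derive1_affine (V : normedModType R) (f : R -> V) (p d : V) (x : R) :
  (\forall y \near x, f y = p + y *: d) -> derive1 f x = d.
Proof.
move=> hf; have fx : f x = p + x *: d by exact: nbhs_singleton hf.
apply: cvg_lim; first exact: norm_hausdorff.
apply: cvg_near_cst.
have c : (h + x) @[h --> (0 : R)] --> x.
  by rewrite -[X in _ --> X]add0r; apply: cvgD; [exact: cvg_id|exact: cvg_cst].
near=> h; have h0 : h != 0 by near: h; exact: nbhs_dnbhs_neq.
have -> : f (h + x) = p + (h + x) *: d.
  by near: h; apply: nbhs_dnbhs; exact: c _ hf.
by rewrite fx opprD addrACA subrr add0r -scalerBl addrK scalerA mulVf// scale1r.
Unshelve. all: by end_near. Qed.

Lemma near_in_mesh (k : 'I_N) x : x \in `]xi k, xi k.+1[ ->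
  \forall y \near x, xi k <= y /\ y <= xi k.+1.
Proof.
rewrite in_itv /= => /andP[kx xk]; apply: filterI.
  by apply: filterS (lt_nbhsr kx) => y /ltW.
by apply: filterS (lt_nbhsl xk) => y /ltW.
Qed.

Lemma derive1_sum_nodal_basis (f : R -> plane R) (F : 'I_N -> plane R) (k : 'I_N) x :
  (forall y, f y = \sum_(j < N) phi j y *: F j) ->
  x \in `]xi k, xi k.+1[ ->
  derive1 f x = (mesh k)^-1 *: (F (ordS k) - F k).
Proof.
move=> hf xk; apply: (@derive1_affine _ _ (F k - (xi k / mesh k) *: (F (ordS k) - F k))).
apply: filterS (near_in_mesh xk) => y [ky yk].
rewrite hf (sum_nodal_basis _ ky yk) /local mulrBl [y *: _]scalerA.
move: (F k) (F (ordS k)) (y / _) (xi k / _) => [a1 a2] [b1 b2] u v.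
by congr pair; rewrite /= /GRing.scale /=; ring.
Qed.

Lemma meshsizeE (k : 'I_N) x : x \in `]xi k, xi k.+1[ -> meshsize N xi x = mesh k.
Proof.
rewrite in_itv /= => /andP[kx xk]; rewrite /meshsize (big_pred1 k)// => i.
apply/idP/eqP => [/andP[ix xi1]|->]; last by rewrite (ltW kx).
apply/ord_inj; have [h|h|//] := ltngtP (i : nat) k.
- have := partition_monotone pxi h (ltnW (ltn_ord k)).
  by rewrite leNgt (lt_trans kx xi1).
- have := partition_monotone pxi h (ltnW (ltn_ord i)).
  by rewrite leNgt (le_lt_trans ix xk).
Qed.

Lemma nodal_basis_Vh (j : 'I_N) (w : plane R) : Vh N xi (fun x => phi j x *: w).
Proof.
have [[[cont per] aff] _] := hphi j; split; first split.
- by move=> x; apply: cvgZ; [exact: cont|exact: cvg_cst].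
- by rewrite per.
- move=> i iN; have [a [b ab]] := aff i iN; exists (a *: w), (b *: w) => x xI.
  by rewrite ab// scalerDl scalerA.
Qed.

End LocalForm.

(** * From the weak formulation to the equations for the vertices *)

Section WeakForm.
Context {R : realType} (N : nat) (xi : nat -> R).
Context (pxi : partition_of_circle N xi) (phi : 'I_N -> R -> R).
Context (hphi : nodal_basis xi phi) (T : R) (X : 'I_N -> R -> plane R).
Context (dX : forall j (t : R), t \in `[0, T] -> time_derivable T (X j) t).

Lemma time_filterE (t : R) : t \in `]0, T[ -> time_filter T t = t^'.
Proof.
move=> tT; apply/seteqP; split => P.
  rewrite /time_filter /within /= => h.
  have tnear : \forall s \near t^', s \in `[0, T].
    move: tT; rewrite in_itv /= => /andP[t0 tT].
    apply: nbhs_dnbhs; apply: filterS2 (lt_nbhsr t0) (lt_nbhsl tT) => s s0 sT.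
    by rewrite in_itv /= !ltW.
  by apply: filterS2 h tnear => s; apply.
by move=> h; apply: filterS h => s Ps _.
Qed.

Lemma mem_itv_oo_cc (t : R) : t \in `]0, T[ -> t \in `[0, T].
Proof. by apply: subset_itvW. Qed.

Definition velocity j t := time_derive T (X j) t.

Lemma cvg_velocity j (t : R) : t \in `]0, T[ ->
  time_quotient (X j) t s @[s --> t^'] --> velocity j t.
Proof.
move=> tT; have := @dX j t (mem_itv_oo_cc tT).
by rewrite /time_derivable /velocity /time_derive time_filterE.
Qed.

Lemma time_derive_Xh x (t : R) : t \in `]0, T[ ->
  time_derive T (Xh phi X x) t = \sum_(j < N) phi j x *: velocity j t.
Proof.
move=> tT; rewrite /time_derive time_filterE//; apply: cvg_lim; first exact: norm_hausdorff.
have -> : time_quotient (Xh phi X x) t =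
    (fun s => \sum_(j < N) phi j x *: time_quotient (X j) t s).
  apply/funext => s; rewrite /time_quotient /Xh -sumrB scaler_sumr.
  by apply: eq_bigr => j _; rewrite -scalerBr !scalerA mulrC.
apply: cvg_big => [|j _]; first by move=> z; exact: add_continuous.
by apply: cvgZ; [exact: cvg_cst|exact: cvg_velocity].
Qed.

Lemma dotZl c (p q : plane R) : dot (c *: p) q = c * dot p q.
Proof. by rewrite /dot /= /GRing.scale /=; ring. Qed.
Lemma dotZr c (p q : plane R) : dot q (c *: p) = c * dot q p.
Proof. by rewrite /dot /= /GRing.scale /=; ring. Qed.
Lemma enormZ c (p : plane R) : 0 <= c -> enorm (c *: p) = c * enorm p.
Proof.
move=> c0; rewrite /enorm dotZl dotZr mulrA -expr2 sqrtrM ?sqr_ge0//.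
by rewrite sqrtr_sqr ger0_norm.
Qed.
Lemma perpZ c (p : plane R) : perp (c *: p) = c *: perp p.
Proof. by rewrite /perp /GRing.scale /=; congr pair; rewrite /GRing.scale /=; ring. Qed.

Section TestFunction.
Context (t : R) (j : 'I_N) (w : plane R) (tT : t \in `]0, T[).
Let Xt (i : 'I_N) := X i t.
Let left (k : 'I_N) : R := (k == j)%:R.
Let right (k : 'I_N) : R := (ordS k == j)%:R.
Let v (x : R) : plane R := phi j x *: w.
Let q k := edge_length Xt (ordS k).
Let dV k := dot (velocity k t) w.
Let dVS k := dot (velocity (ordS k) t) w.


Lemma mem_mesh (k : 'I_N) (x : R) : x \in `]xi k, xi k.+1[ -> xi k <= x /\ x <= xi k.+1.
Proof. by rewrite in_itv /= => /andP[/ltW ? /ltW]. Qed.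

Lemma test_value (k : 'I_N) (x : R) : x \in `]xi k, xi k.+1[ ->
  v x = lerp (left k) (right k) (local xi k x) *: w.
Proof. by move=> /mem_mesh[kx xk]; rewrite /v (nodal_basisE pxi hphi _ kx xk). Qed.

Lemma test_derivative (k : 'I_N) (x : R) : x \in `]xi k, xi k.+1[ ->
  derive1 v x = ((mesh xi k)^-1 * (right k - left k)) *: w.
Proof.
move=> xk; rewrite (@derive1_sum_nodal_basis _ _ _ pxi _ hphi _ (fun i => (i == j)%:R *: w) k)//.
  by rewrite -scalerBl scalerA.
move=> y; rewrite (bigD1 j)//= eqxx scale1r big1 ?addr0// => i /negbTE ->.
by rewrite scale0r scaler0.
Qed.

Lemma position_derivative (k : 'I_N) (x : R) : x \in `]xi k, xi k.+1[ ->
  derive1 (fun y => Xh phi X y t) x = (mesh xi k)^-1 *: edge Xt (ordS k).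
Proof.
move=> xk; rewrite (@derive1_sum_nodal_basis _ _ _ pxi _ hphi _ Xt k)//.
by rewrite edgeS.
Qed.

Lemma speed_value (k : 'I_N) (x : R) : x \in `]xi k, xi k.+1[ ->
  enorm (derive1 (fun y => Xh phi X y t) x) = (mesh xi k)^-1 * q k.
Proof.
by move=> xk; rewrite (position_derivative xk) enormZ ?invr_ge0 ?ltW ?mesh_gt0.
Qed.

Lemma velocity_derivative (k : 'I_N) (x : R) : x \in `]xi k, xi k.+1[ ->
  derive1 (fun x => time_derive T (Xh phi X x) t) x =
  (mesh xi k)^-1 *: (velocity (ordS k) t - velocity k t).
Proof.
move=> xk; apply: (@derive1_sum_nodal_basis _ _ _ pxi _ hphi _ (velocity^~ t) k) => // y.
exact: time_derive_Xh.
Qed.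

Lemma velocity_value (k : 'I_N) (x : R) : x \in `]xi k, xi k.+1[ ->
  dot (time_derive T (Xh phi X x) t) w =
  lerp (dV k) (dVS k) (local xi k x).
Proof.
move=> /mem_mesh[kx xk]; rewrite time_derive_Xh//.
rewrite (sum_nodal_basis pxi hphi (velocity^~ t) kx xk) /dV /dVS.
move: (velocity k t) (velocity (ordS k) t) (local _ _ _) => [a1 a2] [b1 b2] s.
by rewrite /lerp /dot /= /GRing.scale /=; ring.
Qed.

(** The four integrals below are the four terms of the weak formulation for the
test function [v], whose values at the two ends of the interval [k] are [left k]
and [right k] times [w]. *)
Lemma integral_mass :
  integral_circle (fun x => enorm (derive1 (fun y => Xh phi X y t) x) *
    dot (time_derive T (Xh phi X x) t) (v x)) =
  \sum_(k < N) q k * (dV k * left k / 3 +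
     (dV k * right k + dVS k * left k) / 6 + dVS k * right k / 3).
Proof.
rewrite (@integral_circle_lerp _ _ _ pxi _ (fun k => q k / mesh xi k * dV k)
  (fun k => q k / mesh xi k * dVS k) left right).
  apply: eq_bigr => k _; have := lt0r_neq0 (mesh_gt0 pxi k).
  by move: (q k) (mesh xi k) (dV k) (dVS k) (left k) (right k) => a b c d e f b0; field.
move=> k x xk; rewrite (speed_value xk) (test_value xk) dotZr (velocity_value xk).
move: (q k) (mesh xi k) (dV k) (dVS k) (left k) (right k) (local _ _ _).
by move=> a b c d e f s; rewrite /lerp; ring.
Qed.

Lemma integral_stiffness : (forall k, 0 < q k) ->
  integral_circle (fun x => dot
   ((enorm (derive1 (fun y => Xh phi X y t) x))^-1 *: derive1 (fun y => Xh phi X y t) x)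
   (derive1 v x)) =
  \sum_(k < N) (right k - left k) * (dot (edge Xt (ordS k)) w / q k).
Proof.
move=> q0; pose c (k : 'I_N) := (mesh xi k)^-1 * (right k - left k) *
  (dot (edge Xt (ordS k)) w / q k).
rewrite (@integral_circle_lerp _ _ _ pxi _ c c (fun=> 1) (fun=> 1)).
  apply: eq_bigr => k _; have := lt0r_neq0 (mesh_gt0 pxi k).
  rewrite /c; move: (mesh xi k) (right k - left k) (_ / q k) => a b d a0.
  by field.
move=> k x xk; have m0 := mesh_gt0 pxi k.
rewrite (speed_value xk) (position_derivative xk) (test_derivative xk) dotZr !dotZl.
rewrite /c /lerp.
have := lt0r_neq0 m0; have := lt0r_neq0 (q0 k).
move: (mesh xi k) (right k - left k) (q k) (dot _ _) (local _ _ _) => a b d e s d0 a0.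
by field; rewrite d0 a0.
Qed.

Lemma integral_mass_correction :
  integral_circle (fun x => meshsize N xi x ^+ 2 *
    enorm (derive1 (fun y => Xh phi X y t) x) / 6 *
    dot (derive1 (fun x => time_derive T (Xh phi X x) t) x) (derive1 v x)) =
  \sum_(k < N) q k / 6 * (right k - left k) * (dVS k - dV k).
Proof.
pose c (k : 'I_N) := (mesh xi k)^-1 * (q k / 6 * (right k - left k) * (dVS k - dV k)).
rewrite (@integral_circle_lerp _ _ _ pxi _ c c (fun=> 1) (fun=> 1)).
  apply: eq_bigr => k _; have := lt0r_neq0 (mesh_gt0 pxi k).
  rewrite /c; move: (mesh xi k) (q k / 6 * _ * _) => a b a0.
  by field.
move=> k x xk; have m0 := mesh_gt0 pxi k.
rewrite (speed_value xk) (velocity_derivative xk) (test_derivative xk) dotZr !dotZl.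
rewrite (meshsizeE pxi xk).
have -> : dot (velocity (ordS k) t - velocity k t) w = dVS k - dV k.
  rewrite /dVS /dV; move: (velocity k t) (velocity (ordS k) t) => [a1 a2] [b1 b2].
  by rewrite /dot /=; ring.
rewrite /c /lerp; have := lt0r_neq0 m0.
move: (mesh xi k) (right k - left k) (q k) (dVS k - dV k) (local _ _ _) => a b d e s a0.
by field.
Qed.

Lemma integral_forcing c :
  integral_circle (fun x => dot (c *: perp (derive1 (fun y => Xh phi X y t) x)) (v x)) =
  \sum_(k < N) c / 2 * (dot (perp (edge Xt (ordS k))) w * (left k + right k)).
Proof.
pose d (k : 'I_N) := c * ((mesh xi k)^-1 * dot (perp (edge Xt (ordS k))) w).
rewrite (@integral_circle_lerp _ _ _ pxi _ d d left right).
  apply: eq_bigr => k _; have := lt0r_neq0 (mesh_gt0 pxi k).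
  rewrite /d; move: (mesh xi k) (left k) (right k) (dot _ _) => a b e f a0.
  by field.
move=> k x xk; rewrite (position_derivative xk)// perpZ (test_value xk)// dotZr !dotZl.
rewrite /d; move: (mesh xi k) (left k) (right k) (dot _ _) (local _ _ _) => a b e f s.
by rewrite /lerp; ring.
Qed.

(** The exact mass integral and the correction with the squared mesh size add up
to the lumped mass: on the interval [k] their sum is
[q k / 2 * (dV k * left k + dVS k * right k)].  Only the two intervals at the
node [j] contribute. *)
Lemma weak_formulation_nodal : (forall k, 0 < edge_length Xt k) ->
  weak_formulation xi T phi X v t ->
  dot (((edge_length Xt j + edge_length Xt (ordS j)) / 2) *: velocity j t
    + (edge_length Xt j)^-1 *: edge Xt j
    - (edge_length Xt (ordS j))^-1 *: edge Xt (ordS j)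
    + (pi / perimeter Xt) *: perp (edge Xt j + edge Xt (ordS j))) w = 0.
Proof.
move=> q0; rewrite /weak_formulation /= integral_mass (integral_stiffness (fun k => q0 _)).
rewrite integral_mass_correction integral_forcing -!big_split /=.
pose P k := pi / perimeter Xt * dot (perp (edge Xt (ordS k))) w.
pose f k := q k / 2 * dV k - dot (edge Xt (ordS k)) w / q k + P k.
pose g k := q k / 2 * dVS k + dot (edge Xt (ordS k)) w / q k + P k.
rewrite (eq_bigr (fun k => left k * f k + right k * g k)); last first.
  move=> k _; rewrite /f /g /P -/Xt.
  move: (dot (edge _ _) _ / q k) (dot (perp _) _) (perimeter Xt)^-1.
  by move: (q k) (dV k) (dVS k) (left k) (right k) => a b c d e x y z; field.
rewrite big_split /= (bigD1 j)//= {1}/left eqxx mul1r big1 ?addr0; last first.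
  by move=> i /negbTE ij; rewrite /left ij mul0r.
rewrite (bigD1 (ord_pred j))//= {1}/right ord_predK eqxx mul1r big1 ?addr0; last first.
  move=> i ij; rewrite /right; have [h|_] := eqVneq (ordS i) j; last by rewrite mul0r.
  by move: ij; rewrite -h ordSK eqxx.
move=> <-; rewrite /f /g /P /dV /dVS /q ord_predK.
move: (velocity j t) (edge Xt j) (edge Xt (ordS j)) => [v1 v2] [a1 a2] [b1 b2].
move: (edge_length Xt j) (edge_length Xt (ordS j)) (pi / _) => x y z.
by rewrite /dot /perp /= /GRing.scale /=; ring.
Qed.

End TestFunction.

(** The test vector can be the residual of the equation itself. *)
Lemma weak_formulation_flow (t : R) : t \in `]0, T[ ->
  (forall k, 0 < edge_length (X^~ t) k) ->
  (forall v, Vh N xi v -> weak_formulation xi T phi X v t) ->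
  flow_velocity (X^~ t) (velocity^~ t).
Proof.
move=> tT q0 hw j; apply/eqP; rewrite -subr_eq0.
have E (a b c d : plane R) : a - (b - c - d) = a + c - b + d.
  by rewrite !opprB [d + _]addrC !addrA.
rewrite E; apply/negP => /negP; rewrite -dot_gt0 weak_formulation_nodal ?ltxx//.
by apply: hw; exact: nodal_basis_Vh.
Qed.
End WeakForm.

(** * Motions on a time interval *)

Section TimeExtension.
Context {R : realType}.

Lemma is_derive_of_quotient (g : R -> R) (t l : R) :
  (s - t)^-1 * (g s - g t) @[s --> t^'] --> l -> is_derive t 1 g l.
Proof.
move=> h.
have shift_dnbhs : (e + t) @[e --> (0 : R)^'] --> t^'.
  move=> P Pt; have c : (e + t) @[e --> (0 : R)] --> t.
    by rewrite -[X in _ --> X]add0r; apply: cvgD; [exact: cvg_id|exact: cvg_cst].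
  have H : \forall e \near (0 : R), e + t != t -> P (e + t) by exact: c _ Pt.
  suff : \forall e \near (0 : R), e != 0 -> P (e + t) by [].
  by apply: filterS H => e He e0; apply: He; rewrite -subr_eq0 addrK.
have q : (fun e => e^-1 *: ((g \o shift t) (e *: 1) - g t)) @ (0 : R)^' --> l.
  have := cvg_comp _ _ shift_dnbhs h; apply: cvg_trans; apply: near_eq_cvg.
  by near=> e; rewrite /= addrK /GRing.scale /= mulr1.
by split; [apply/cvg_ex; exists l|exact: cvg_lim].
Unshelve. all: by end_near. Qed.

Lemma has_velocity_of_quotient (g : R -> plane R) (t : R) (v : plane R) :
  time_quotient g t s @[s --> t^'] --> v -> has_velocity g t v.
Proof.
move=> h.
have c1 : (time_quotient g t s).1 @[s --> t^'] --> v.1.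
  by apply: cvg_comp h _; exact: cvg_fst.
have c2 : (time_quotient g t s).2 @[s --> t^'] --> v.2.
  by apply: cvg_comp h _; exact: cvg_snd.
by split; apply: is_derive_of_quotient; [exact: c1|exact: c2].
Qed.

Lemma time_derivable_continuous (T : R) (g : R -> plane R) (t : R) :
  time_derivable T g t -> g s @[s --> within `[0, T] (nbhs t)] --> g t.
Proof.
move=> /cvg_ex[l hl] P Pt.
have h : (g t + (s - t) *: time_quotient g t s) @[s --> time_filter T t] --> g t.
  rewrite -[X in _ --> X]addr0 -(scale0r l); apply: cvgD; first exact: cvg_cst.
  apply: cvgZ hl; rewrite -(subrr t); apply: cvgB; last exact: cvg_cst.
  by apply: cvg_within_filter; apply: cvg_within_filter; exact: cvg_id.
have H : \forall s \near t, s != t -> s \in `[0, T] ->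
    P (g t + (s - t) *: time_quotient g t s) by exact: h _ Pt.
suff : \forall s \near t, s \in `[0, T] -> P (g s) by [].
apply: filterS H => s H sT; have [->|st] := eqVneq s t; first exact: nbhs_singleton Pt.
have := H st sT; rewrite /time_quotient scalerA divff ?subr_eq0// scale1r.
by rewrite addrC subrK.
Qed.

(** Freezing a motion outside of the time interval makes it continuous on the
whole line, which avoids one-sided limits at the endpoints. *)
Definition clamp (T t : R) : R := Num.max 0 (Num.min t T).

Lemma clamp_id (T t : R) : 0 <= t -> t <= T -> clamp T t = t.
Proof. by move=> t0 tT; rewrite /clamp min_l// max_r. Qed.

Lemma clamp_itv (T t : R) : 0 <= T -> 0 <= clamp T t /\ clamp T t <= T.
Proof.
by move=> T0; rewrite /clamp le_max lexx ge_max T0 ge_min lexx orbT.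
Qed.

Lemma clamp_continuous (T : R) : continuous (clamp T).
Proof.
move=> t; apply: (@continuous_max _ _ (cst 0) (fun t => Num.min t T)); first exact: cvg_cst.
by apply: (@continuous_min _ _ id (cst T)); [exact: cvg_id|exact: cvg_cst].
Qed.

Lemma clamp_extension_continuous (T : R) (g : R -> plane R) : 0 <= T ->
  (forall t, t \in `[0, T] -> time_derivable T g t) ->
  continuous (fun t => g (clamp T t)).
Proof.
move=> T0 dg t; have [c0 cT] := clamp_itv t T0.
have /time_derivable_continuous cg : time_derivable T g (clamp T t).
  by apply: dg; rewrite in_itv /= c0.
apply: cvg_comp cg => P hP.
have H : \forall s \near t, clamp T s \in `[0, T] -> P (clamp T s).
  exact: (@clamp_continuous T t _ hP).
apply: filterS H => s Ps; apply: Ps.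
by rewrite in_itv /=; apply/andP; exact: clamp_itv.
Qed.

End TimeExtension.

(** * Preservation of convexity *)

Theorem theorem2p3 (R : realType) (N : nat) (hN : (3 <= N)%N)
  (xi : nat -> R) (hxi : partition_of_circle N xi)
  (phi : 'I_N -> R -> R) (hphi : nodal_basis xi phi)
  (T : R) (hT : 0 < T)
  (X0 : R -> plane R) (hX0 : continuous_on_circle X0)
  (X : 'I_N -> R -> plane R)
  (hX : semidiscrete_solution xi T phi X0 X)
  (hinit : convex_Npolygon (fun j => X j 0))
  (hq : forall t, t \in `[0, T] ->
          forall j : 'I_N, 0 < edge_length (fun i => X i t) j) :
  forall t, t \in `[0, T] -> convex_Npolygon (fun j => X j t).
Proof.
have [dX _ wX] := hX; have T0 := ltW hT.
pose Y (t : R) j := X j (clamp T t).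
have YX (t : R) : 0 <= t -> t <= T -> Y t = (fun j => X j t).
  by move=> t0 tT; apply/funext => j; rewrite /Y clamp_id.
have cY j : continuous (fun t => Y t j).
  by apply: clamp_extension_continuous => // t; exact: dX.
have dY (t : R) : t \in `]0, T[ -> forall j,
    has_velocity (fun s => Y s j) t (velocity T X j t).
  move=> tT j; apply: has_velocity_of_quotient.
  have := @cvg_velocity _ _ _ _ dX j t tT; apply: cvg_trans; apply: near_eq_cvg.
  have tnear : \forall s \near t^', 0 <= s /\ s <= T.
    move: tT; rewrite in_itv /= => /andP[t0 tT]; apply: nbhs_dnbhs.
    apply: filterS2 (lt_nbhsr t0) (lt_nbhsl tT) => s s0 sT; split; exact: ltW.
  apply: filterS tnear => s [s0 sT].
  move: tT; rewrite in_itv /= /time_quotient /Y => /andP[/ltW t0 /ltW tT].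
  by rewrite !clamp_id.
have fY (t : R) : t \in `]0, T[ -> flow_velocity (Y t) (fun j => velocity T X j t).
  move=> tT; have tT' := mem_itv_oo_cc tT; have := tT'.
  rewrite in_itv /= => /andP[t0 tT''].
  rewrite YX//; apply: (weak_formulation_flow hxi hphi dX tT) => [k|v hv].
    exact: hq.
  exact: wX.
have qY (t : R) : t \in `[0, T] -> forall j, 0 < edge_length (Y t) j.
  move=> tT; have := tT; rewrite in_itv /= => /andP[t0 tT']; rewrite YX//.
  exact: hq.
have s0 : strictly_convex (Y 0) by rewrite YX//; exact: convex_Npolygon_strict.
move=> t; rewrite in_itv /= => /andP[t0 tT]; rewrite -YX//.
apply: strictly_convex_Npolygon => //.
exact: (@strictly_convex_flow _ _ hN T Y (fun t j => velocity T X j t) cY dY fY qY).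
Qed.
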